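(* For the weak-star convergence of measures on the compact space $\mathbb{S}^1_\infty\times (\widehat K/R)$, we have, as $n\rightarrow+\infty$, $$ \frac{1}{q^2(q-1)} \;q^{-2n} \sum_{v\in R^2_{{\rm prim}}\;:\;\|v\|_\infty= q^n} \Delta_{\mathrm{dir}(v)}\otimes\Delta_{\frac{z_{w_{v}}}{z_v}+R}\;\;\overset{*}\rightharpoonup\;\; \mu_{\mathbb{S}^1_\infty}\otimes \mu_{\widehat K/R}\;. $$ Furthermore, there exists $\tau\in\;]0,\frac{1}{8}]$ such that for all $\epsilon,\delta>0$, this equidistribution holds with a multiplicative error term of the form $1+\operatorname{O}_{\delta}(q^{2n(-\tau+\delta)}\,\|f\|_\epsilon\,\|g\|_\epsilon)$ when evaluated on $(f,g)$ for all $\epsilon$-locally constant maps $f:\mathbb{S}^1_\infty\rightarrow\mathbb{R}$ and $g:\widehat K/R\rightarrow\mathbb{R}$, that is, $$ \frac{1}{q^2(q-1)} \;q^{-2n}\sum_{v\in R^2_{{\rm prim}}\;:\;\|v\|_\infty= q^n} f(\mathrm{dir}(v))\,g\Big(\frac{z_{w_{v}}}{z_v}+R\Big) =\Big(\int_{\mathbb{S}^1_\infty} f\,d\mu_{\mathbb{S}^1_\infty}\Big)\Big(\int_{\widehat K/R} g\,d\mu_{\widehat K/R}\Big)\Big(1+\operatorname{O}_{\delta}\big(q^{2n(-\tau+\delta)}\,\|f\|_\epsilon\,\|g\|_\epsilon\big)\Big). $$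
   Context: Let $\mathbb{F}_q$ be a finite field of order $q$ (a positive power of a prime), $K=\mathbb{F}_q(Y)$, $R=\mathbb{F}_q[Y]$, $\widehat K=\mathbb{F}_q((Y^{-1}))$ the field of formal Laurent series in $Y^{-1}$, and ${\cal O}=\mathbb{F}_q[[Y^{-1}]]$. Let $|\cdot|$ be the nonarchimedean absolute value on $\widehat K$ with $|P|=q^{\deg P}$ for $P\in R$. Endow $\widehat K$ with its Haar measure $\mu_{\widehat K}$ normalized by $\mu_{\widehat K}({\cal O})=1$, the quotient $\widehat K/R$ with the induced measure $\mu_{\widehat K/R}$, and the plane $\widehat K^{\,2}$ with the product measure and the supremum norm $\|(a,b)\|_\infty=\max\{|a|,|b|\}\in q^{\mathbb{Z}}$. Let $\mathbb{S}^1_\infty$ be the (compact-open) unit sphere of $\widehat K^{\,2}$ for this norm, with $\mu_{\mathbb{S}^1_\infty}$ the restriction of the product measure. For $v=(a,b)\in\widehat K^{\,2}-\{0\}$, let $z_v=a$ if $|a|\geq|b|$ and $z_v=b$ otherwise, and let $\mathrm{dir}(v)=\big(a\,Y^{-\log_q\|v\|_\infty},\, b\,Y^{-\log_q\|v\|_\infty}\big)\in\mathbb{S}^1_\infty$ (the direction of $v$). Let $R^2_{\rm prim}=\{(a,b)\in R^2: aR+bR=R\}$. For $v=(a,b)\in R^2_{\rm prim}$, let $w_v=(-y',x')$ where $(x',y')\in R^2$ is a solution of $ax+by=1$ (e.g. the one of smallest supremum norm); the statement does not depend on this choice. $\Delta_x$ denotes the unit Dirac mass at $x$. For a metric space $E$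 and $\epsilon>0$, a bounded map $f:E\to\mathbb{R}$ is $\epsilon$-locally constant if it is constant on every closed ball of radius $\epsilon$, and its $\epsilon$-locally constant norm is $\|f\|_\epsilon=\frac{1}{\epsilon}\sup_{x\in E}|f(x)|$.
   Formalization: The multiplicative error 1+O(...) is false as written (replace f by λf, λ→0); the formal theorem bounds the difference of the two sides additively by O_δ(q^{2n(-τ+δ)} ‖f‖_ε ‖g‖_ε), for all n ≥ n_0(δ). *)

(* Defs.v *)
From HB Require Import structures.
From mathcomp Require Import all_boot all_order all_algebra.
From mathcomp Require Import all_classical all_reals all_analysis.
From Stdlib Require Import ClassicalEpsilon.
Set Implicit Arguments. Unset Strict Implicit. Unset Printing Implicit Defensive.
Import Order.TTheory GRing.Theory Num.Theory numFieldNormedType.Exports.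
Local Open Scope ring_scope.
Local Open Scope classical_set_scope.

Section Defs.
Variable R : realType.
Variable F : finFieldType.

Definition qR : R := (#|F|%:R : R).

(* ---------- Laurent series K^ = F((Y^-1)) ----------
   A Laurent series is its coefficient map  k |-> coefficient of Y^k  (k : int),
   whose support is bounded above. *)
Definition laurent := int -> F.
Definition is_laurent (x : laurent) : Prop :=
  exists N : int, forall k : int, N < k -> x k = 0.
Definition polyLS (P : {poly F}) : laurent :=
  fun k => if 0 <= k then P`_(`|k|%N) else 0.
Definition pmulLS (Q : {poly F}) (x : laurent) : laurent :=
  fun k => \sum_(i < size Q) Q`_i * x (k - (i : nat)%:Z).
(* P / Q in K^ : the Laurent series x with Q * x = P (unique when Q != 0) *)
Definition divLS (P Q : {poly F}) : laurent :=
  epsilon (inhabits (fun _ : int => 0 : F))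
    (fun x => is_laurent x /\ pmulLS Q x = polyLS P).

(* ---------- K^/R ----------
   Every class x + R has a unique representative in Y^-1 F[[Y^-1]]
   (the fractional part); a point of K^/R is encoded by the coefficient
   sequence k |-> coefficient of Y^(-(k+1)) of that representative. *)
Definition quot := nat -> F.
Definition fracLS (x : laurent) : quot := fun k => x (- (k.+1 : nat)%:Z).

(* ---------- O = F[[Y^-1]], S^1_infty ----------
   An element of O is encoded by k |-> coefficient of Y^(-k). *)
Definition ser := nat -> F.
(* unit sphere of O^2 = K^2 (sup norm = 1) *)
Definition inS1 (x : ser * ser) : Prop := x.1 0%N != 0 \/ x.2 0%N != 0.

(* closed balls: d(x,y) <= e  (sup norm on pairs; |x - y| = q^-(first diff.)) *)
Definition closeS (e : R) (x y : ser * ser) : Prop :=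
  forall i : nat, e < qR ^- i -> x.1 i = y.1 i /\ x.2 i = y.2 i.
(* quotient distance on K^/R, with representatives in Y^-1 O *)
Definition closeQ (e : R) (x y : quot) : Prop :=
  forall k : nat, e < qR ^- k.+1 -> x k = y k.

Definition loc_constS (e : R) (f : ser * ser -> R) : Prop :=
  (exists M : R, forall x, inS1 x -> `|f x| <= M) /\
  forall x y, inS1 x -> inS1 y -> closeS e x y -> f x = f y.
Definition loc_constQ (e : R) (g : quot -> R) : Prop :=
  (exists M : R, forall x, `|g x| <= M) /\
  forall x y, closeQ e x y -> g x = g y.
Definition normS (e : R) (f : ser * ser -> R) : R :=
  e^-1 * sup [set `|f x| | x in [set x | inS1 x]].
Definition normQ (e : R) (g : quot -> R) : R :=
  e^-1 * sup [set `|g x| | x in [set: quot]].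

Definition ext (m : nat) (u : {ffun 'I_m -> F}) : nat -> F :=
  fun i => if @insub _ (fun j => (j < m)%N) 'I_m i is Some j then u j else 0.

(* ---------- Haar integrals (of continuous functions) ----------
   Riemann sums over the partition in balls of radius q^-(k+1) (of measure
   q^-(k+1) in O, the normalization being mu(O) = 1). *)
Definition intS1 (f : ser * ser -> R) : R :=
  limn (fun k : nat => qR ^- (2 * k.+1) *
    \sum_(u : {ffun 'I_k.+1 -> F}) \sum_(w : {ffun 'I_k.+1 -> F} |
        (u ord0 != 0) || (w ord0 != 0)) f (ext u, ext w)).
(* K^/R with the measure induced by mu_K^ : fundamental domain Y^-1 O *)
Definition intQ (g : quot -> R) : R :=
  limn (fun k : nat => qR ^- k.+1 * \sum_(c : {ffun 'I_k -> F}) g (ext c)).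
Definition intSQ (h : (ser * ser) * quot -> R) : R :=
  limn (fun k : nat => qR ^- (2 * k.+1) * qR ^- k.+2 *
    \sum_(u : {ffun 'I_k.+1 -> F}) \sum_(w : {ffun 'I_k.+1 -> F} |
        (u ord0 != 0) || (w ord0 != 0))
      \sum_(c : {ffun 'I_k.+1 -> F}) h ((ext u, ext w), ext c)).

Definition contSQ (h : (ser * ser) * quot -> R) : Prop :=
  forall x, inS1 x.1 -> forall e : R, 0 < e -> exists eta : R, 0 < eta /\
    forall y, inS1 y.1 -> closeS eta x.1 y.1 -> closeQ eta x.2 y.2 ->
      `|h y - h x| < e.

Definition prim (v : {poly F} * {poly F}) : Prop :=
  exists x y : {poly F}, v.1 * x + v.2 * y = 1.
(* dir(v) for ||v|| = q^n : coefficients of a Y^-n, b Y^-n in Y^-1 *)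
Definition dirc (p : {poly F}) (n : nat) : ser :=
  fun k => if (k <= n)%N then p`_(n - k) else 0.
Definition dirv (n : nat) (v : {poly F} * {poly F}) : ser * ser :=
  (dirc v.1 n, dirc v.2 n).
Definition zv (v : {poly F} * {poly F}) : {poly F} :=
  if (size v.2 <= size v.1)%N then v.1 else v.2.
(* w_v = (-y', x') where (x', y') = sol v solves a x' + b y' = 1 *)
Definition wv (sol : {poly F} * {poly F} -> {poly F} * {poly F})
  (v : {poly F} * {poly F}) : {poly F} * {poly F} := (- (sol v).2, (sol v).1).
Definition zquot sol (v : {poly F} * {poly F}) : quot :=
  fracLS (divLS (zv (wv sol v)) (zv v)).

Definition polc (m : nat) (c : {ffun 'I_m -> F}) : {poly F} := \poly_(i < m) ext c i.

(* integral of H against  1/(q^2(q-1)) q^-2n sum_{v prim, ||v|| = q^n}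
   Delta_dir(v) (x) Delta_{z_w/z_v + R}.  Polynomials with ||v|| <= q^n are
   enumerated bijectively as polc c, c : 'I_(n+1) -> F. *)
Definition nu_sum sol (n : nat) (H : ser * ser -> quot -> R) : R :=
  (qR ^+ 2 * (qR - 1))^-1 * qR ^- (2 * n) *
  \sum_(c : {ffun 'I_n.+1 -> F}) \sum_(d : {ffun 'I_n.+1 -> F} |
      `[< prim (polc c, polc d) /\ maxn (size (polc c)) (size (polc d)) = n.+1 >])
    H (dirv n (polc c, polc d)) (zquot sol (polc c, polc d)).

End Defs.

(* Main.v *)
(* Fix A of degree n.  For v = (A, B) with |B| <= |A|, the point z_(w_v) / z_v + R is
   -B^-1 / A mod R, so one has to show that the pairs (B, B^-1) of units modulo A are
   equidistributed among the boxes prescribing the M leading digits of B / A and of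
   B^-1 / A (the vectors with |A| < |B| are handled in the same way).  This is
   Kloosterman's fourth moment argument, carried out without characters.  The variance
   of the box counts is a sum over pairs of units u, v of a function of
   (u - v, u^-1 - v^-1).  Average that function over the dilations (w x, w^-1 y) by
   units w and apply the Cauchy-Schwarz inequality.  The coincidences among the points
   (u - v, u^-1 - v^-1) come from factorisations of 0 into three factors modulo A, hence
   are controlled by the residues having a gcd of degree >= n/3 with A, which are rare on
   average over A.  The correlation of two dilates vanishes unless w' / w satisfies a
   linear relation modulo A with coefficients of degree < M, which excludes all but
   q^(3M) ratios.  This gives a total error O(q^(2n + M - n/15)), whence tau = 1/30.

   The number of units modulo A, summed over A with prescribed leading coefficients, is
   independent of these coefficients up to the same error, because coprimality is
   symmetric in A and B; its total is computed exactly.  A locally constant function only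
   depends on finitely many digits, and a continuous one is uniformly continuous. *)
Require Import Defs.
From HB Require Import structures.
From mathcomp Require Import all_boot all_order all_algebra.
From mathcomp Require Import all_classical all_reals all_analysis.
From mathcomp Require Import ring lra zify.
From Stdlib Require Import ClassicalEpsilon.
Set Implicit Arguments. Unset Strict Implicit. Unset Printing Implicit Defensive.
Import Order.TTheory GRing.Theory Num.Theory numFieldNormedType.Exports.
Local Open Scope ring_scope.

(** * Units of a finite commutative ring *)

Lemma ler_of_eq (R : numDomainType) (x y : R) : x = y -> x <= y.
Proof. by move->. Qed.

Lemma sum_sqr_ge0 (R : realDomainType) (I : finType) (P : pred I) (a : I -> R) :
  0 <= \sum_(i | P i) a i ^+ 2.
Proof. by apply: sumr_ge0 => i _; apply: sqr_ge0. Qed.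

Lemma mulr_sum_sum (R : comPzRingType) (I J : finType) (P : pred I) (Q : pred J) (a : I -> R) (b : J -> R) :
  (\sum_(i | P i) a i) * (\sum_(j | Q j) b j) =
  \sum_(i | P i) \sum_(j | Q j) a i * b j.
Proof.
rewrite mulr_suml; apply: eq_bigr => i _; by rewrite mulr_sumr.
Qed.

Lemma sumr_const_card (R : pzRingType) (I : finType) (c : R) : \sum_(i : I) c = #|I|%:R * c.
Proof. by rewrite sumr_const mulr_natl. Qed.

(** Lagrange's identity: twice the difference of the two sides is a sum of squares. *)
Lemma cauchy_schwarz (R : realFieldType) (I : finType) (a b : I -> R) :
  (\sum_i a i * b i) ^+ 2 <= (\sum_i a i ^+ 2) * (\sum_i b i ^+ 2).
Proof.
have H : 0 <= \sum_i \sum_j (a i * b j - a j * b i) ^+ 2.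
  by apply: sumr_ge0 => i _; apply: sum_sqr_ge0.
have E : \sum_i \sum_j (a i * b j - a j * b i) ^+ 2 =
   2 * ((\sum_i a i ^+ 2) * (\sum_i b i ^+ 2) - (\sum_i a i * b i) ^+ 2).
  have -> : \sum_i \sum_j (a i * b j - a j * b i) ^+ 2 =
    \sum_i \sum_j (a i ^+ 2 * b j ^+ 2) + \sum_i \sum_j (b i ^+ 2 * a j ^+ 2)
    - 2 * \sum_i \sum_j ((a i * b i) * (a j * b j)).
    rewrite mulr_sumr -big_split -sumrB /=; apply: eq_bigr => i _.
    rewrite mulr_sumr -big_split -sumrB /=; apply: eq_bigr => j _; ring.
  rewrite -!mulr_sum_sum expr2; ring.
by move: H; rewrite E pmulr_rge0 // subr_ge0.
Qed.

Section Kloosterman.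
(** In the application G is F[X] modulo A, H the residues of small degree, D the residues sharing a
    large factor with A, and B the exceptional ratios. The classes of [p1] and [p2] are the cosets
    of H, and a box is a pair of classes. [badP] says that for t outside B the conditions x in H and
    t x in H are at worst independent. *)
Variables (R : realFieldType) (G : finComUnitRingType) (H D B : {set G}).
Variables (I : finType) (p1 p2 : G -> I).
Hypothesis p1P : forall x y, (p1 x == p1 y) = (x - y \in H).
Hypothesis p2P : forall x y, (p2 x == p2 y) = (x - y \in H).
Hypothesis cardHI : (#|H| * #|I| = #|G|)%N.
Hypothesis deepP : forall x y z : G, x * y * z = 0 -> [|| x \in D, y \in D | z \in D].
Hypothesis badP : forall t : G, t \is a GRing.unit -> t \notin B ->
  (#|[set x in H | (t * x \in H)%R]| * #|I| <= #|H|)%N.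

Local Notation U := [pred x : G | x \is a GRing.unit].
Local Notation h x := ((x \in H)%:R : R).
Local Notation nU := ((#|U|)%:R : R).
Local Notation nI := ((#|I|)%:R : R).
Local Notation nG := ((#|G|)%:R : R).
Local Notation nH := ((#|H|)%:R : R).
Let kap : R := nI ^- 2.

Definition unit_count (i j : I) : R :=
  \sum_(u in U) ((p1 u == i) && (p2 u^-1 == j))%:R.
Local Notation N := unit_count.

Let Phi (x y : G) : R := h x * h y - kap.
Let V : R := \sum_i \sum_j (N i j - kap * nU) ^+ 2.

Lemma nI_gt0 : 0 < nI.
Proof. by rewrite ltr0n; apply/card_gt0P; exists (p1 0). Qed.
Lemma nU_gt0 : 0 < nU.
Proof. by rewrite ltr0n; apply/card_gt0P; exists 1; rewrite inE unitr1. Qed.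
Lemma card_mul_index : nH * nI = nG. Proof. by rewrite -natrM cardHI. Qed.
Lemma index_sqr_kap : nI ^+ 2 * kap = 1.
Proof. by rewrite /kap mulfV // expf_neq0 // gt_eqF // nI_gt0. Qed.

Lemma sum_eq1 (T : finType) (a : T) : \sum_i ((a == i)%:R : R) = 1.
Proof.
rewrite (bigD1 a) //= eqxx big1 ?addr0 // => i ia.
by rewrite eq_sym (negPf ia).
Qed.

Lemma sum_eq2 (T : finType) (a b : T) :
  \sum_i ((a == i)%:R * (b == i)%:R : R) = (a == b)%:R.
Proof.
rewrite (bigD1 a) //= eqxx big1 ?addr0 ?mul1r 1?eq_sym // => i ia.
by rewrite eq_sym (negPf ia) mul0r.
Qed.

Lemma sum_unit_count : \sum_i \sum_j N i j = nU.
Proof.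
under eq_bigr do rewrite exchange_big /=.
rewrite exchange_big /=.
rewrite -sum1_card natr_sum; apply: eq_bigr => u _.
rewrite -[RHS](sum_eq1 (p1 u)); apply: eq_bigr => i _.
under eq_bigr do rewrite -mulnb natrM.
by rewrite -mulr_sumr sum_eq1 mulr1.
Qed.

Lemma sum_unit_count_sqr : \sum_i \sum_j N i j ^+ 2 =
  \sum_(u in U) \sum_(v in U) h (u - v) * h (u^-1 - v^-1).
Proof.
rewrite (eq_bigr (fun i => \sum_(u in U) \sum_(v in U)
   ((p1 u == i)%:R * (p1 v == i)%:R) * (p2 u^-1 == p2 v^-1)%:R)); last first.
  move=> i _; rewrite (eq_bigr (fun j => \sum_(u in U) \sum_(v in U)
    (((p1 u == i) && (p2 u^-1 == j))%:R * ((p1 v == i) && (p2 v^-1 == j))%:R))); last first.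
    by move=> j _; rewrite expr2 mulr_sum_sum.
  rewrite exchange_big; apply: eq_bigr => u _.
  rewrite exchange_big; apply: eq_bigr => v _.
  rewrite -(sum_eq2 (p2 u^-1)) mulr_sumr; apply: eq_bigr => j _.
  by rewrite -!mulnb !natrM; ring.
rewrite exchange_big; apply: eq_bigr => u _.
rewrite exchange_big; apply: eq_bigr => v _.
by rewrite -mulr_suml sum_eq2 p1P p2P.
Qed.

(** Open the square: since nI^2 kap = 1, the cross term and the square of the mean combine to - kap
    nU^2, which is spread as the constant - kap of [Phi] over the nU^2 pairs of units. *)
Lemma variance_pairs : V = \sum_(u in U) \sum_(v in U) Phi (u - v) (u^-1 - v^-1).
Proof.
have -> : V = \sum_i (\sum_j N i j ^+ 2 - (2 * (kap * nU)) * \sum_j N i j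
    + nI * (kap * nU) ^+ 2).
  apply: eq_bigr => i _; have -> : nI * (kap * nU) ^+ 2 = \sum_(j : I) (kap * nU) ^+ 2 by rewrite sumr_const mulr_natl.
  rewrite mulr_sumr -sumrB -big_split /=.
  by apply: eq_bigr => j _; rewrite sqrrB; ring.
rewrite big_split /= sumrB -mulr_sumr sum_unit_count sum_unit_count_sqr.
have -> : \sum_(u in U) \sum_(v in U) Phi (u - v) (u^-1 - v^-1) =
  \sum_(u in U) (\sum_(v in U) h (u - v) * h (u^-1 - v^-1) - nU * kap).
  by apply: eq_bigr => u uU; rewrite /Phi sumrB sumr_const mulr_natl.
rewrite sumrB !sumr_const -[_ *+ #|I|]mulr_natl -[X in _ = _ - X]mulr_natl.
have := index_sqr_kap; set k := kap; set i := nI => Hk.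
have -> : i * (i * (k * nU) ^+ 2) = (i ^+ 2 * k) * k * nU ^+ 2 by ring.
rewrite Hk; ring.
Qed.

Lemma sum_unit_dilate (w : G) (f : G -> R) : w \is a GRing.unit ->
  \sum_(u in U) f u = \sum_(u in U) f (w * u).
Proof.
move=> wU; rewrite (reindex_inj (mulrI wU)) /=.
by apply: eq_bigl => u; rewrite !inE unitrMr.
Qed.

(* The measure sum_u delta_(u, u^-1) is invariant under the dilations
   (x, y) |-> (w x, w^-1 y), so the test function Phi may be averaged over them. *)
Let Psi (x y : G) : R := \sum_(w in U) Phi (w * x) (w^-1 * y).

Lemma variance_dilate : nU * V = \sum_(u in U) \sum_(v in U) Psi (u - v) (u^-1 - v^-1).
Proof.
transitivity (\sum_(w in U) \sum_(u in U) \sum_(v in U)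
    Phi (w * (u - v)) (w^-1 * (u^-1 - v^-1))).
  rewrite mulr_natl -sumr_const; apply: eq_bigr => w wU.
  rewrite variance_pairs (sum_unit_dilate _ (w := w)) //; apply: eq_bigr => u uU.
  rewrite (sum_unit_dilate _ (w := w)) //; apply: eq_bigr => v vU.
  by rewrite !invrM // ![_ * w^-1]mulrC -!mulrBr.
rewrite exchange_big; apply: eq_bigr => u _.
by rewrite exchange_big; apply: eq_bigr => v _.
Qed.

(** Counts the pairs of points of the hyperbola x y = 1 with difference z; its second moment counts
    coincidences among these differences. *)
Let rho (z : G * G) : R :=
  \sum_(u in U) \sum_(v in U) ((u - v, u^-1 - v^-1) == z)%:R.

Lemma variance_differences : nU * V = \sum_z rho z * Psi z.1 z.2.
Proof.
rewrite variance_dilate; under [RHS]eq_bigr do rewrite mulr_suml.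
rewrite [RHS]exchange_big; apply: eq_bigr => u _ /=.
under [RHS]eq_bigr do rewrite mulr_suml.
rewrite [RHS]exchange_big; apply: eq_bigr => v _ /=.
rewrite (bigD1 (u - v, u^-1 - v^-1)) //= eqxx mul1r big1 ?addr0 // => z zn.
by rewrite eq_sym (negPf zn) mul0r.
Qed.

Lemma sum_indic (T : finType) (A : {set T}) : \sum_x ((x \in A)%:R : R) = #|A|%:R.
Proof.
rewrite -sum1_card natr_sum [RHS]big_mkcond /=; apply: eq_bigr => x _.
by case: (x \in A).
Qed.

(* If u - v = u' - v' and u^-1 - v^-1 = u'^-1 - v'^-1 with all four invertible,
   then (u - v) (u' - u) (u' + v) = 0. *)
Lemma sum_rho_sqr_le : \sum_z rho z ^+ 2 <= 3 * #|D|%:R * nG ^+ 2.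
Proof.
pose d (x : G) : R := (x \in D)%:R.
have d0 x : 0 <= d x by rewrite ler0n.
pose t3 (u v u' : G) : R := d (u - v) + d (u' - u) + d (u' + v).
have -> : \sum_z rho z ^+ 2 = \sum_(u in U) \sum_(v in U) \sum_(u' in U) \sum_(v' in U)
    ((u - v, u^-1 - v^-1) == (u' - v', u'^-1 - v'^-1))%:R.
  under eq_bigr do rewrite expr2 mulr_sum_sum.
  rewrite exchange_big; apply: eq_bigr => u _ /=.
  transitivity (\sum_z \sum_(v in U) \sum_(u' in U) \sum_(v' in U)
     ((u - v, u^-1 - v^-1) == z)%:R * ((u' - v', u'^-1 - v'^-1) == z)%:R : R).
    apply: eq_bigr => z _; under eq_bigr do rewrite mulr_sum_sum.
    by rewrite exchange_big; apply: eq_bigr.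
  rewrite exchange_big; apply: eq_bigr => v _ /=.
  rewrite exchange_big; apply: eq_bigr => u' _ /=.
  rewrite exchange_big; apply: eq_bigr => v' _ /=.
  by rewrite sum_eq2.
apply: (@le_trans _ _ (\sum_(u in U) \sum_(v in U) \sum_(u' in U) t3 u v u')).
  apply: ler_sum => u uU; apply: ler_sum => v vU; apply: ler_sum => u' u'U.
  (* The first coordinate forces v' = u' - u + v, so the sum over v' has at most one nonzero
     term. *)
  apply: (@le_trans _ _ (\sum_v' (u' - u + v == v')%:R * t3 u v u')); last first.
    by rewrite -mulr_suml sum_eq1 mul1r.
  rewrite big_mkcond /=; apply: ler_sum => v' _.
  have t30 : 0 <= t3 u v u' by rewrite !addr_ge0.
  case: ifP => v'U; last by rewrite mulr_ge0.
  case: eqP => [[e1 e2]|_]; last by rewrite mulr_ge0.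
  have eu : u = u' - v' + v by rewrite -e1; ring.
  have ev : u' - u + v = v' by rewrite {1}eu; ring.
  rewrite ev eqxx mul1r.
  have : (u - v) * (u' - u) * (u' + v) = 0.
    have [[Uu Uv] [Uu' Uv']] : (u \is a GRing.unit /\ v \is a GRing.unit) /\
      (u' \is a GRing.unit /\ v' \is a GRing.unit) by [].
    (* Multiplying by the four units clears the inverses. *)
    transitivity ((u * v * u' * v') * ((u'^-1 - v'^-1) - (u^-1 - v^-1))); last by rewrite e2 subrr mulr0.
    have -> : (u * v * u' * v') * ((u'^-1 - v'^-1) - (u^-1 - v^-1)) =
       (u' / u') * (u * v * v') - (v' / v') * (u * v * u') - (u / u) * (v * u' * v') + (v / v) * (u * u' * v') by ring.
    by rewrite !divrr // -ev; ring.
  move/deepP; rewrite /t3 /d => /or3P[] ->.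
  - by rewrite -addrA lerDl addr_ge0.
  - by rewrite [X in X + _]addrC -addrA lerDl addr_ge0.
  - by rewrite addrC lerDl addr_ge0.
pose t4 := \sum_u \sum_v \sum_u' t3 u v u'.
apply: (@le_trans _ _ t4).
  rewrite big_mkcond; apply: ler_sum => u _; case: ifP => _; last first.
    by do 2!apply: sumr_ge0 => ? _; rewrite !addr_ge0.
  rewrite big_mkcond; apply: ler_sum => v _; case: ifP => _; last first.
    by apply: sumr_ge0 => ? _; rewrite !addr_ge0.
  rewrite big_mkcond; apply: ler_sum => u' _; case: ifP => _ //.
  by rewrite !addr_ge0.
have sumd c : \sum_x d (x + c) = #|D|%:R.
  by rewrite -sum_indic [RHS](reindex_inj (addIr c)).
have -> : t4 = \sum_(u : G) \sum_(v : G) (nG * d (u - v)) + \sum_(u : G) \sum_(v : G) (#|D|%:R : R)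
    + \sum_(u : G) \sum_(v : G) (#|D|%:R : R).
  rewrite -!big_split; apply: eq_bigr => u _; rewrite -!big_split; apply: eq_bigr => v _ /=.
  by rewrite !big_split /= !sumd sumr_const mulr_natl.
rewrite exchange_big /= (eq_bigr (fun=> nG * #|D|%:R)); last first.
  by move=> v _; rewrite -mulr_sumr sumd.
rewrite !sumr_const_card.
by apply: ler_of_eq; ring.
Qed.

Let c0 (t : G) := #|[set x in H | t * x \in H]|.

Lemma c0_inv (t : G) : t \is a GRing.unit -> c0 t^-1 = c0 t.
Proof.
move=> tU; rewrite /c0 -[RHS](card_imset _ (mulrI tU)); apply: eq_card => y.
apply/idP/imsetP => [|[x xH ->]].
  rewrite inE => /andP[yH tyH]; exists (t^-1 * y); last by rewrite mulVKr.
  by rewrite inE mulVKr // tyH.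
by move: xH; rewrite !inE mulKr // andbC.
Qed.

Lemma sum_dilate_indic (w : G) : w \is a GRing.unit -> \sum_x h (w * x) = nH.
Proof. by move=> wU; rewrite -sum_indic [RHS](reindex_inj (mulrI wU)). Qed.

Lemma sum_dilate_indic2 (w w' : G) : w \is a GRing.unit ->
  \sum_x h (w * x) * h (w' * x) = (c0 (w' / w))%:R.
Proof.
move=> wU; have wU' : w^-1 \is a GRing.unit by rewrite unitrV.
rewrite /c0 -sum_indic [LHS](reindex_inj (mulrI wU')) /=.
by apply: eq_bigr => x _; rewrite inE mulVKr // mulrA -mulnb natrM.
Qed.

(** Every dilate of [Phi] has mean zero because nH nI = nG, so only the product of the indicators
    and one constant term survive. The two coordinates involve the ratios w' / w and w / w', which
    have the same [c0]. *)
Lemma Phi_corr (w w' : G) : w \is a GRing.unit -> w' \is a GRing.unit ->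
  \sum_(z : G * G) Phi (w * z.1) (w^-1 * z.2) * Phi (w' * z.1) (w'^-1 * z.2)
   = (c0 (w' / w))%:R ^+ 2 - kap * nH ^+ 2.
Proof.
move=> wU w'U.
rewrite -(pair_bigA _ (fun x y => Phi (w * x) (w^-1 * y) * Phi (w' * x) (w'^-1 * y))) /=.
have -> : \sum_i \sum_j Phi (w * i) (w^-1 * j) * Phi (w' * i) (w'^-1 * j) =
  (\sum_i h (w * i) * h (w' * i)) * (\sum_i h (w^-1 * i) * h (w'^-1 * i))
  - kap * ((\sum_i h (w * i)) * (\sum_i h (w^-1 * i)))
  - kap * ((\sum_i h (w' * i)) * (\sum_i h (w'^-1 * i)))
  + \sum_(i : G) \sum_(j : G) kap ^+ 2.
  rewrite !mulr_sum_sum !mulr_sumr -!sumrB -!big_split /=; apply: eq_bigr => i _.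
  rewrite !mulr_sumr -!sumrB -!big_split /=; apply: eq_bigr => j _.
  by rewrite /Phi; ring.
rewrite !sumr_const_card !sum_dilate_indic ?unitrV // !sum_dilate_indic2 ?unitrV // invrK.
have -> : c0 (w'^-1 * w) = c0 (w' / w).
  by rewrite -[LHS]c0_inv ?unitrMl ?unitrV // invrM ?unitrV // invrK mulrC.
rewrite -card_mul_index; have := index_sqr_kap; move: kap nH nI => k a b E.
have -> : a * b * (a * b * k ^+ 2) = a ^+ 2 * (b ^+ 2 * k) * k by ring.
by rewrite E; ring.
Qed.

(** For a ratio outside B, [badP] makes the correlation nonpositive, which suffices for an upper
    bound; for a ratio in B the trivial bound [c0] <= nH is used. *)
Lemma Phi_corr_le (w w' : G) : w \is a GRing.unit -> w' \is a GRing.unit ->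
  \sum_(z : G * G) Phi (w * z.1) (w^-1 * z.2) * Phi (w' * z.1) (w'^-1 * z.2)
   <= nH ^+ 2 * (w' / w \in B)%:R.
Proof.
move=> wU w'U; rewrite Phi_corr //.
have kap0 : 0 <= kap by rewrite invr_ge0 exprn_ge0 // ler0n.
have [tB|tB] := boolP (_ \in B).
  rewrite mulr1 lerBlDr (le_trans (y := nH ^+ 2)) //.
    rewrite lerXn2r ?nnegrE ?ler0n // ler_nat.
    by apply/subset_leq_card/fintype.subsetP => x; rewrite inE => /andP[].
  by rewrite lerDl mulr_ge0 // exprn_ge0 // ler0n.
rewrite mulr0 subr_le0.
have := badP _ tB; rewrite unitrMl ?unitrV // => /(_ w'U).
rewrite -/(c0 _) -(ler_nat R) natrM => Hc.
set c := _%:R in Hc *.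
have -> : c ^+ 2 = kap * (c * nI) ^+ 2.
  have -> : kap * (c * nI) ^+ 2 = (nI ^+ 2 * kap) * c ^+ 2 by ring.
  by rewrite index_sqr_kap mul1r.
by rewrite ler_wpM2l // lerXn2r ?nnegrE // ?mulr_ge0 ?ler0n.
Qed.

Lemma sum_Psi_sqr_le : \sum_z Psi z.1 z.2 ^+ 2 <= nU * #|B|%:R * nH ^+ 2.
Proof.
have -> : \sum_z Psi z.1 z.2 ^+ 2 = \sum_(w in U) \sum_(w' in U)
   \sum_(z : G * G) Phi (w * z.1) (w^-1 * z.2) * Phi (w' * z.1) (w'^-1 * z.2).
  under eq_bigr do rewrite expr2 mulr_sum_sum.
  rewrite exchange_big; apply: eq_bigr => w _ /=.
  by rewrite exchange_big.
apply: (@le_trans _ _ (\sum_(w in U) nH ^+ 2 * #|B|%:R)); last first.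
  by rewrite sumr_const -mulr_natl; apply: ler_of_eq; ring.
apply: ler_sum => w wU.
apply: (@le_trans _ _ (\sum_w' nH ^+ 2 * (w' / w \in B)%:R)).
  rewrite big_mkcond; apply: ler_sum => w' _; case: ifP => w'U.
    exact: Phi_corr_le.
  by rewrite mulr_ge0 ?exprn_ge0 ?ler0n.
rewrite -mulr_sumr ler_wpM2l ?exprn_ge0 ?ler0n //.
rewrite -sum_indic [X in _ <= X](reindex_inj (mulIr (_ : w^-1 \is a GRing.unit))) //.
by rewrite unitrV.
Qed.

(** Cauchy-Schwarz on [variance_differences] bounds (nU V)^2 by the product of the two second
    moments; one factor nU cancels. *)
Lemma variance_le : nU * V ^+ 2 <= 3 * #|D|%:R * nG ^+ 2 * (#|B|%:R * nH ^+ 2).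
Proof.
have := cauchy_schwarz rho (fun z => Psi z.1 z.2); rewrite -variance_differences => H1.
rewrite -(ler_pM2l nU_gt0).
have -> : nU * (nU * V ^+ 2) = (nU * V) ^+ 2 by ring.
apply: (le_trans H1).
rewrite [leRHS](_ : _ = (3 * #|D|%:R * nG ^+ 2) * (nU * #|B|%:R * nH ^+ 2)); last by ring.
apply: ler_pM; [exact: sum_sqr_ge0|exact: sum_sqr_ge0|exact: sum_rho_sqr_le|exact: sum_Psi_sqr_le].
Qed.

Definition unit_discrepancy : R := \sum_i \sum_j `|N i j - kap * nU|.

Lemma unit_discrepancy_ge0 : 0 <= unit_discrepancy.
Proof. by do 2!apply: sumr_ge0 => ? _. Qed.

Lemma unit_discrepancy_le2 : unit_discrepancy <= 2 * nU.
Proof.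
apply: (@le_trans _ _ (\sum_i \sum_j (N i j + kap * nU))).
  apply: ler_sum => i _; apply: ler_sum => j _.
  rewrite (le_trans (ler_normB _ _)) // !ger0_norm //.
    by rewrite mulr_ge0 ?ler0n // invr_ge0 exprn_ge0 // ler0n.
  by apply: sumr_ge0 => u _; rewrite ler0n.
under eq_bigr do rewrite big_split /= sumr_const_card.
rewrite big_split /= sumr_const_card sum_unit_count.
have -> : nI * (nI * (kap * nU)) = (nI ^+ 2 * kap) * nU by ring.
by rewrite index_sqr_kap; lra.
Qed.

Lemma unit_discrepancy_sqr : unit_discrepancy ^+ 2 <= nI ^+ 2 * V.
Proof.
have := cauchy_schwarz (fun=> 1 : R) (fun z : I * I => `|N z.1 z.2 - kap * nU|).
under eq_bigr do rewrite mul1r.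
rewrite sumr_const_card card_prod natrM expr1n mulr1 -expr2.
rewrite -(pair_bigA _ (fun i j => `|N i j - kap * nU|)) /=.
under [X in _ <= _ * X]eq_bigr do rewrite real_normK ?num_real //.
by rewrite -(pair_bigA _ (fun i j => (N i j - kap * nU) ^+ 2)) /=.
Qed.

(** Cauchy-Schwarz over the boxes gives L^4 <= nI^4 V^2, whereas [variance_le] controls nU V^2. The
    missing factor nU comes from the trivial bound L <= 2 nU, whence the fifth power. *)
Theorem unit_discrepancy_bound :
  unit_discrepancy ^+ 5 <= 6 * #|D|%:R * #|B|%:R * nI ^+ 2 * nG ^+ 4.
Proof.
set L := unit_discrepancy.
have L0 : 0 <= L := unit_discrepancy_ge0.
have V0 : 0 <= V by apply: sumr_ge0 => i _; apply: sum_sqr_ge0.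
have L4 : L ^+ 4 <= nI ^+ 4 * V ^+ 2.
  rewrite (_ : 4 = 2 * 2)%N // 2!exprM -exprMn lerXn2r ?nnegrE ?exprn_ge0 //.
    by rewrite mulr_ge0 // exprn_ge0 ?ler0n.
  exact: unit_discrepancy_sqr.
rewrite exprS; apply: (@le_trans _ _ (2 * nU * (nI ^+ 4 * V ^+ 2))).
  by apply: ler_pM => //; [rewrite exprn_ge0|exact: unit_discrepancy_le2].
have := variance_le => VB.
have -> : 2 * nU * (nI ^+ 4 * V ^+ 2) = 2 * nI ^+ 4 * (nU * V ^+ 2) by ring.
have nI4 : 0 <= 2 * nI ^+ 4 by rewrite mulr_ge0 // exprn_ge0 // ler0n.
apply: (le_trans (ler_wpM2l nI4 VB)).
by rewrite -card_mul_index; apply: ler_of_eq; ring.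
Qed.

End Kloosterman.

(** * Quotients of F[X] *)

HB.instance Definition _ (F : finFieldType) (h : {poly F}) := Finite.on {poly %/ h}.

Section QuotientRing.
Variables (F : finFieldType) (h : {poly F}) (n M s : nat).
Hypothesis (n_gt0 : (0 < n)%N) (sz_h : size h = n.+1) (h_monic : h \is monic).

Local Notation G := {poly %/ h}.
Local Notation q := #|F|.

(** The ring [{poly %/ h}] reduces modulo [mk_monic h], which is a default modulus unless h is monic
    and nonconstant. *)
Lemma mk_monicE : mk_monic h = h.
Proof. by rewrite /mk_monic sz_h ltnS n_gt0 h_monic. Qed.

Lemma size_quot (x : G) : (size (x : {poly F}) <= n)%N.
Proof. by apply: leq_trans (size_npoly x) _; rewrite mk_monicE sz_h. Qed.

Lemma val_in_qpoly (p : {poly F}) : in_qpoly h p = p %% h :> {poly F}.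
Proof. by rewrite /= mk_monicE Pdiv.IdomainMonic.modpE. Qed.

Lemma in_qpolyK (x : G) : in_qpoly h x = x.
Proof. by apply: val_inj; exact: in_qpoly_small (size_mk_monic x). Qed.

Lemma in_qpoly_eq0 (p : {poly F}) : (in_qpoly h p == 0) = (h %| p).
Proof. by rewrite /dvdp -val_in_qpoly -val_eqE. Qed.

Lemma in_qpoly_id (p : {poly F}) : (size p <= n)%N -> in_qpoly h p = p :> {poly F}.
Proof. by move=> sp; rewrite val_in_qpoly modp_small // sz_h. Qed.

Lemma quot_unit (x : G) : (x \is a GRing.unit) = coprimep h x.
Proof.
have -> : coprimep h x = coprimep (mk_monic h) x by congr (coprimep _ _); rewrite mk_monicE.
apply/idP/idP => [/mulVr xV|].
  exact: qpoly_intro_unit xV.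
move=> cx; apply/unitrP; exists (qpoly_inv x).
by rewrite qpoly_mulVz // qpoly_mulzV.
Qed.

Definition short_set : {set G} := [set x : G | (size (x : {poly F}) + M <= n)%N].
Definition deep_set : {set G} := [set x : G | (s <= (size (gcdp h x)).-1)%N].
Local Notation H := short_set.
Local Notation D := deep_set.

(** If h divides x y z, it also divides the product of the gcds of h with x, y and z. Three gcds of
    degree < s have total degree at most 3 s - 3 < n, too small for a nonzero multiple of h. *)
Lemma deep_setP (x y z : G) : (3 * s <= n + 2)%N ->
  x * y * z = 0 -> [|| x \in D, y \in D | z \in D].
Proof.
move=> sn.
have -> : x * y * z = in_qpoly h ((x : {poly F}) * (y : {poly F}) * (z : {poly F})).
  by rewrite !in_qpolyM !in_qpolyK.
move/eqP; rewrite in_qpoly_eq0 => dv.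
rewrite !inE; apply: contraT; rewrite !negb_or -!ltnNge => /and3P[gx gy gz].
have h0 : h != 0 by rewrite -size_poly_eq0 sz_h.
have g0 (u : {poly F}) : gcdp h u != 0 by rewrite gcdp_eq0 negb_and h0.
have d1 (u v : {poly F}) : h %| u * v -> h %| gcdp h u * v.
  by move=> huv; rewrite (eqp_dvdr _ (mulp_gcdl _ _ _)) dvdp_gcd huv dvdp_mulr.
have d3 (a b c : {poly F}) : h %| a * b * c -> h %| gcdp h a * gcdp h b * gcdp h c.
  rewrite -mulrA => /d1; rewrite mulrCA => /d1; rewrite mulrCA mulrA mulrC => /d1.
  by rewrite mulrC.
have := d3 _ _ _ dv.
move/dvdp_leq; rewrite !mulf_neq0 ?g0 // sz_h => /(_ isT).
rewrite !size_mul ?mulf_neq0 ?g0 //.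
have p0 u : (0 < size (gcdp h u))%N by rewrite size_poly_gt0.
move: (p0 x) (p0 y) (p0 z) gx gy gz; lia.
Qed.

Lemma card_quot : #|G| = (q ^ n)%N.
Proof. by rewrite card_monic_qpoly ?sz_h // ltnS n_gt0. Qed.

Lemma card_short_set : (M <= n)%N -> #|H| = (q ^ (n - M))%N.
Proof.
move=> Mn; rewrite -(card_npoly F (n - M)).
have sz (y : {poly_(n - M)%N F}) : (size (y : {poly F}) <= n)%N.
  by apply: leq_trans (size_npoly y) _; rewrite leq_subr.
have inj : injective (fun y : {poly_(n - M)%N F} => in_qpoly h y).
  move=> y z /(congr1 (fun x : G => (x : {poly F}))).
  by rewrite !in_qpoly_id ?sz // => /val_inj.
rewrite -(card_codom inj); apply: eq_card => x; rewrite inE.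
apply/idP/codomP => [sx|[y ->]].
  exists (npolyp (n - M)%N x); apply: val_inj.
  transitivity (npolyp (n - M)%N x : {poly F}); last exact/esym/in_qpoly_id/sz.
  by rewrite npolypK // -(leq_add2r M) subnK.
rewrite in_qpoly_id ?sz //.
by rewrite (leq_trans (leq_add (size_npoly y) (leqnn M))) // subnK.
Qed.

(* For t outside this set, the 2M elements X^i and X^i t (i < M) are independent. *)
Definition bad_set : {set G} :=
  [set t | [exists uk : {poly_M F} * {poly_M F},
     (uk != 0) && (in_qpoly h uk.1 + in_qpoly h uk.2 * t == 0)]].

(** A relation lifts to u + k t = r h with r of degree < M. Here k is nonzero, as h cannot divide a
    nonzero u of degree < M <= n, so t is determined by the triple (u, k, r). *)
Lemma card_bad_set : (M <= n)%N -> (#|bad_set| <= q ^ (3 * M))%N.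
Proof.
move=> Mn.
pose f (z : {poly_M F} * {poly_M F} * {poly_M F}) : G :=
  in_qpoly h ((h * z.2 - z.1.1) %/ z.1.2).
have -> : (q ^ (3 * M) = #|{: {poly_M F} * {poly_M F} * {poly_M F}}|)%N.
  by rewrite !card_prod !card_npoly -!expnD; congr (_ ^ _)%N; lia.
apply: leq_trans (leq_imset_card f predT).
apply/subset_leq_card/fintype.subsetP => t; rewrite inE => /existsP[[u k] /= /andP[uk0]].
have -> : in_qpoly h u + in_qpoly h k * t = in_qpoly h ((u : {poly F}) + (k : {poly F}) * (t : {poly F})).
  by rewrite in_qpolyD in_qpolyM in_qpolyK.
rewrite in_qpoly_eq0 => dv.
have h0 : h != 0 by rewrite -size_poly_eq0 sz_h.
have k0 : (k : {poly F}) != 0.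
  apply: contraNneq uk0 => k0; rewrite k0 mul0r addr0 in dv.
  have u0 : (u : {poly F}) = 0.
    apply/eqP; apply: contraTT dv => u0; rewrite gtNdvdp //.
    by rewrite sz_h ltnS (leq_trans (size_npoly u)).
  by rewrite -pair_eqE /pair_eq /= -!val_eqE /= k0 u0 !eqxx.
have /dvdpP[r Er] := dv.
have sr : (size r <= M)%N.
  have [->|r0] := eqVneq r 0; first by rewrite size_poly0.
  have : (size ((u : {poly F}) + (k : {poly F}) * (t : {poly F}))%R <= n + M)%N.
    apply: leq_trans (size_polyD _ _) _; rewrite geq_max.
    rewrite (leq_trans (size_npoly u)) ?leq_addl //=.
    apply: leq_trans (size_polyMleq _ _) _.
    rewrite addnC (leq_trans (leq_pred _)) //.
    by rewrite (leq_add (size_quot t) (size_npoly k)).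
  by rewrite Er size_mul // sz_h addnS /= addnC leq_add2l.
apply/imsetP; exists (u, k, npolyp M r); rewrite ?inE // /f /=.
by rewrite npolypK // mulrC -Er addrC addKr mulrC mulpK // in_qpolyK.
Qed.

Lemma short_set_lin (x : G) (l : nat) : (M <= n)%N -> x \in H -> (l < M)%N ->
  (in_qpoly h 'X^l * x : {poly F})`_n.-1 = 0.
Proof.
move=> Mn; rewrite inE => xH lM.
have -> : in_qpoly h 'X^l * x = in_qpoly h ('X^l * (x : {poly F})).
  by rewrite in_qpolyM in_qpolyK.
have sz : (size ('X^l * (x : {poly F}))%R <= n.-1)%N.
  apply: leq_trans (size_polyMleq _ _) _; rewrite size_polyXn addSn /=.
  apply: (@leq_trans (l + (n - M))%N); last by lia.
  by rewrite leq_add2l -(leq_add2r M) subnK.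
by rewrite in_qpoly_id ?nth_default // (leq_trans sz) // leq_pred.
Qed.

(** If y is nonzero, multiplying it by the power of X that raises its degree to n - 1 makes its
    leading coefficient visible, without any reduction. *)
Lemma lin_nondeg (y : G) :
  (forall i, (i < n)%N -> (in_qpoly h 'X^i * y : {poly F})`_n.-1 = 0) -> y = 0.
Proof.
move=> Hy; apply/eqP; apply: contraT => y0.
have yp0 : (y : {poly F}) != 0 by rewrite -val_eqE in y0.
have sy := size_quot y; have sy0 : (0 < size (y : {poly F}))%N by rewrite size_poly_gt0.
have := Hy (n - size (y : {poly F}))%N.
have -> : in_qpoly h 'X^(n - size (y : {poly F})) * y =
   in_qpoly h ('X^(n - size (y : {poly F})) * (y : {poly F})).
  by rewrite in_qpolyM in_qpolyK.
rewrite in_qpoly_id; last first.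
  by apply: leq_trans (size_polyMleq _ _) _; rewrite size_polyXn addSn /= subnK.
rewrite coefXnM ifF; last by lia.
have -> : (n.-1 - (n - size (y : {poly F})) = (size (y : {poly F})).-1)%N by lia.
move/(_ _)/eqP; rewrite -lead_coefE lead_coef_eq0 (negPf yp0) => /(_ _).
by apply; lia.
Qed.

(* lam (x y) is a perfect pairing, and a short element is orthogonal to
   X^i for all i < M. *)
Let lam (y : G) : F := (y : {poly F})`_n.-1.

Lemma lam_sum (I : Type) (r : seq I) (P : pred I) (y : I -> G) :
  lam (\sum_(i <- r | P i) y i) = \sum_(i <- r | P i) lam (y i).
Proof. by rewrite /lam poly_of_qpoly_sum coef_sum. Qed.

Lemma lam_scale (c : F) (y : G) : lam (in_qpoly h c%:P * y) = c * lam y.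
Proof.
rewrite /lam.
have -> : in_qpoly h c%:P * y = in_qpoly h (c%:P * (y : {poly F})).
  by rewrite in_qpolyM in_qpolyK.
rewrite in_qpoly_id ?coefCM // mul_polyC (leq_trans (size_scale_leq _ _)) //.
exact: size_quot.
Qed.

Lemma in_qpoly_rVpoly (d : nat) (r : 'rV[F]_d) :
  in_qpoly h (rVpoly r) = \sum_i in_qpoly h (r 0 i)%:P * in_qpoly h 'X^i.
Proof.
rewrite {1}[r]row_sum_delta linear_sum rmorph_sum /=; apply: eq_bigr => i _.
by rewrite linearZ /= rVpoly_delta -mul_polyC in_qpolyM.
Qed.

(** The rows of [W] represent the forms x |-> lam (X^i x) and x |-> lam (X^i t x) for i < M. They
    are independent because t is not bad, and all vanish on [Z]. So [Z] lies in a subspace of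
    codimension 2M, whereas [H] has codimension M. *)
Lemma bad_setP (t : G) : (M <= n)%N -> t \notin bad_set ->
  (#|[set x in H | (t * x)%R \in H]| * q ^ M <= #|H|)%N.
Proof.
move=> Mn tB; set Z := [set x in _ | _].
pose w (l : 'I_(M + M)) : G :=
  match fintype.split l with inl i => in_qpoly h 'X^i | inr i => in_qpoly h 'X^i * t end.
have wl i : w (lshift M i) = in_qpoly h 'X^i by rewrite /w (unsplitK (inl i)).
have wr i : w (rshift M i) = in_qpoly h 'X^i * t by rewrite /w (unsplitK (inr i)).
pose W : 'M[F]_(M + M, n) := \matrix_(l, i) lam (in_qpoly h 'X^i * w l).
have freeW : row_free W.
  apply: inj_row_free => v vW.
  have S0 : \sum_l in_qpoly h (v 0 l)%:P * w l = 0.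
    apply: lin_nondeg => i ni; rewrite -/(lam _) mulr_sumr lam_sum.
    transitivity ((v *m W) 0 (Ordinal ni)); last by rewrite vW mxE.
    by rewrite mxE; apply: eq_bigr => l _; rewrite mxE mulrCA lam_scale.
  have E : in_qpoly h (rVpoly (lsubmx v)) + in_qpoly h (rVpoly (rsubmx v)) * t = 0.
    rewrite -S0 big_split_ord /= !in_qpoly_rVpoly mulr_suml; congr (_ + _).
      by apply: eq_bigr => i _; rewrite wl mxE.
    by apply: eq_bigr => i _; rewrite wr mxE mulrA.
  move: tB; rewrite inE negb_exists => /forallP/(_ (rVnpoly (lsubmx v), rVnpoly (rsubmx v))).
  have nE (r : 'rV[F]_M) : rVnpoly r = rVpoly r :> {poly F}.
    by rewrite /= /rVnpoly /= val_insubd /= qualifE /= size_poly.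
  rewrite !nE E eqxx andbT negbK -pair_eqE /pair_eq /= => /andP[/eqP l0 /eqP r0].
  rewrite -[v]hsubmxK.
  have z0 (r : 'rV[F]_M) : rVnpoly r = 0 -> r = 0.
    by move=> /(congr1 (fun x : {poly_M F} => (x : {poly F}))); rewrite nE => E0; rewrite -[r]rVpolyK E0 linear0.
  by rewrite (z0 _ l0) (z0 _ r0) row_mx0.
have /row_freeP[C WC] := freeW.
pose mu (y : G) := W *m (poly_rV (y : {poly F}) : 'rV_n)^T.
have muD (y z : G) : mu (y + z) = mu y + mu z.
  rewrite /mu -mulmxDr -linearD -linearD; congr (_ *m _^T).
have muZ (x : G) : x \in Z -> mu x = 0.
  rewrite inE => /andP[xH txH]; apply/matrixP => l k; rewrite !mxE.
  transitivity (lam (w l * x)).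
    rewrite -[x in RHS]in_qpolyK.
    have -> : (x : {poly F}) = rVpoly (poly_rV (x : {poly F}) : 'rV_n).
      by rewrite poly_rV_K // size_quot.
    rewrite in_qpoly_rVpoly mulr_sumr lam_sum; apply: eq_bigr => i _.
    by rewrite !mxE mulrCA lam_scale mulrC coef_rVpoly_ord mxE [_ * w l]mulrC.
  rewrite -[l]fintype.splitK; case: (fintype.split l) => i /=; rewrite ?wl ?wr.
    by rewrite /lam short_set_lin.
  by rewrite -mulrA /lam short_set_lin.
(* The right inverse [C] of [W] gives a section of [mu]; translating [Z] by it yields q^(2M)
   disjoint copies of [Z] in G. *)
pose f (z : G * 'rV[F]_(M + M)) : G := z.1 + in_qpoly h (rVpoly (C *m z.2^T)^T).
have muf z : z.1 \in Z -> mu (f z) = z.2^T.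
  move=> zZ; rewrite /f muD muZ // add0r /mu in_qpoly_id ?size_poly //.
  by rewrite rVpolyK trmxK mulmxA WC mul1mx.
have finj : {in finset.setX Z finset.setT &, injective f}.
  move=> [z1 z2] [z'1 z'2]; rewrite !finset.in_setX => /andP[zZ _] /andP[z'Z _] E.
  have := muf (z1, z2) zZ; rewrite E muf // => /(congr1 trmx); rewrite !trmxK /= => e2.
  by move: E; rewrite /f /= e2 => /addIr ->.
have := max_card (f @: finset.setX Z finset.setT).
rewrite card_in_imset // finset.cardsX cardsT card_mx mul1n card_quot card_short_set //.
have q0 : (0 < q ^ M)%N by rewrite expn_gt0; apply/orP; left; apply/card_gt0P; exists 0.
by rewrite -[X in (_ <= _ ^ X)%N -> _](subnK Mn) !expnD mulnA leq_pmul2r.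
Qed.

(** The exponent collects 3M from the bad ratios, 2M from the square of the number of classes, and
    4n from the fourth power of the order of the ring. *)
Lemma quot_discrepancy (R : realFieldType) (I : finType) (p1 p2 : G -> I) :
  (M <= n)%N -> (3 * s <= n + 2)%N -> #|I| = (q ^ M)%N ->
  (forall x y, (p1 x == p1 y) = (x - y \in H)) ->
  (forall x y, (p2 x == p2 y) = (x - y \in H)) ->
  unit_discrepancy R p1 p2 ^+ 5 <= 6 * #|D|%:R * q%:R ^+ (5 * M + 4 * n).
Proof.
move=> Mn sn cI p1P p2P.
have HI : (#|H| * #|I| = #|G|)%N.
  by rewrite cI card_short_set // card_quot -expnD subnK.
have bP t : t \is a GRing.unit -> t \notin bad_set ->
    (#|[set x in H | (t * x)%R \in H]| * #|I| <= #|H|)%N.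
  by move=> _ tB; rewrite cI bad_setP.
apply: le_trans (unit_discrepancy_bound R p1P p2P HI _ bP) _.
  by move=> x y z; apply: deep_setP.
rewrite cI card_quot !natrX -!exprM -!mulrA ler_wpM2l // ler_wpM2l // -exprD.
apply: (@le_trans _ _ (q%:R ^+ (3 * M) * q%:R ^+ (M * 2 + n * 4))).
  by rewrite ler_wpM2r ?exprn_ge0 ?ler0n // -natrX ler_nat card_bad_set.
by rewrite -exprD; apply: ler_of_eq; congr (_ ^+ _); lia.
Qed.
End QuotientRing.

(** * Pairs of polynomials by degree of the gcd *)

Section GcdCount.
Variable F : finFieldType.
Local Notation q := #|F|.

Definition monic_gcd (a b : {poly F}) := (lead_coef (gcdp a b))^-1 *: gcdp a b.

Lemma monic_gcd_monic (a b : {poly F}) : a != 0 -> monic_gcd a b \is monic.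
Proof.
move=> a0; have g0 : gcdp a b != 0 by rewrite gcdp_eq0 negb_and a0.
by rewrite monicE lead_coefZ mulVf // lead_coef_eq0.
Qed.

Lemma monic_gcd_eqp (a b : {poly F}) : a != 0 -> monic_gcd a b %= gcdp a b.
Proof.
move=> a0; have g0 : gcdp a b != 0 by rewrite gcdp_eq0 negb_and a0.
by rewrite eqp_scale // invr_eq0 lead_coef_eq0.
Qed.

Lemma monic_gcd_mul (g a b : {poly F}) : g \is monic -> a != 0 -> coprimep a b ->
  monic_gcd (g * a) (g * b) = g.
Proof.
move=> gm a0 cab; have ga0 : g * a != 0 by rewrite mulf_neq0 // monic_neq0.
apply/eqP; rewrite -eqp_monic //; last exact: monic_gcd_monic.
apply: eqp_trans (monic_gcd_eqp _ ga0) _.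
apply: eqp_trans (gcdp_mul2l _ _ _) _.
by rewrite -{2}[g]mulr1 eqp_mul2l ?monic_neq0 // -size_poly_eq1.
Qed.

Lemma monic_gcd_factor (a b : {poly F}) : a != 0 ->
  exists u v, [/\ a = monic_gcd a b * u, b = monic_gcd a b * v, u != 0 & coprimep u v].
Proof.
move=> a0; have g0 : gcdp a b != 0 by rewrite gcdp_eq0 negb_and a0.
have E := monic_gcd_eqp b a0; set g := monic_gcd a b in E *.
have gn0 : g != 0 by rewrite monic_neq0 // monic_gcd_monic.
have ga : g %| a by rewrite (eqp_dvdl _ E) dvdp_gcdl.
have gb : g %| b by rewrite (eqp_dvdl _ E) dvdp_gcdr.
exists (a %/ g), (b %/ g); rewrite ![g * _]mulrC !divpK //; split=> //.
  by rewrite dvdp_div_eq0.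
rewrite /coprimep size_poly_eq1 -(@eqp_mul2l _ g) // mulr1.
apply: eqp_trans (mulp_gcdr _ _ _) _.
by rewrite ![g * (_ %/ _)]mulrC !divpK // eqp_sym.
Qed.

(** As the size exceeds the degree by one, the last condition asks for a gcd of degree at least
    s. *)
Definition gcd_pairs (n s : nat) : {set {poly_n.+1 F} * {poly_n F}} :=
  [set z : {poly_n.+1 F} * {poly_n F} | (size (z.1 : {poly F}) == n.+1) &&
           (s < size (gcdp (z.1 : {poly F}) (z.2 : {poly F})))%N].

(* (g u, g v) |-> ((g X + l) u, (g X + l) v) for g monic and u, v coprime: this is
   a bijection onto the pairs in degree n + 1 whose gcd has one degree more. *)
Definition gcd_shift n (z : F * ({poly_n.+1 F} * {poly_n F})) :
    {poly_n.+2 F} * {poly_n.+1 F} :=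
  let g := monic_gcd z.2.1 z.2.2 in
  (npolyp n.+2 (((z.2.1 : {poly F}) %/ g) * (g * 'X + z.1%:P)),
   npolyp n.+1 (((z.2.2 : {poly F}) %/ g) * (g * 'X + z.1%:P))).

Lemma mulXaddC_inj (g g' : {poly F}) (l l' : F) :
  g * 'X + l%:P = g' * 'X + l'%:P -> g = g' /\ l = l'.
Proof.
move=> E; have el : l = l'.
  by move: (congr1 (fun p : {poly F} => p`_0) E); rewrite !coefD !coefMX !coefC /= !add0r.
by split=> //; move: E; rewrite el => /addIr /(mulIf (monic_neq0 (monicX F))).
Qed.

Lemma monic_mulXaddC (g : {poly F}) (l : F) : g \is monic -> g * 'X + l%:P \is monic.
Proof.
move=> gm; have g0 : (0 < size g)%N by rewrite size_poly_gt0 monic_neq0.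
rewrite monicE lead_coefDl; first by rewrite lead_coefM lead_coefX mulr1 -monicE.
by rewrite size_mulX ?monic_neq0 // (leq_ltn_trans (size_polyC_leq1 _)).
Qed.

Lemma size_mulXaddC (g : {poly F}) (l : F) : g \is monic ->
  size (g * 'X + l%:P) = (size g).+1.
Proof.
move=> gm; have g0 : (0 < size g)%N by rewrite size_poly_gt0 monic_neq0.
rewrite size_polyDl size_mulX ?monic_neq0 // (leq_ltn_trans (size_polyC_leq1 _)) //.
Qed.

(** Replacing g by g X + l raises degrees by exactly one, so the truncations [npolyp] in [gcd_shift]
    change nothing. *)
Lemma gcd_shiftE n (z : F * ({poly_n.+1 F} * {poly_n F})) (u v g : {poly F}) :
  g \is monic -> u != 0 -> coprimep u v -> size (g * u) = n.+1 ->
  z.2.1 = g * u :> {poly F} -> z.2.2 = g * v :> {poly F} ->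
  (gcd_shift z).1 = (g * 'X + z.1%:P) * u :> {poly F} /\
  (gcd_shift z).2 = (g * 'X + z.1%:P) * v :> {poly F}.
Proof.
case: z => l [A B] /= gm u0 cuv sz EA EB; rewrite /gcd_shift /= EA EB monic_gcd_mul //.
have gn0 := monic_neq0 gm.
have dsz := size_mulXaddC l gm; have d0 := monic_neq0 (monic_mulXaddC l gm).
rewrite !mulKp // [u * _]mulrC [v * _]mulrC; split; rewrite npolypK //.
  by rewrite size_mul // dsz addSn /= -sz size_mul // leqSpred.
have [->|v0] := eqVneq v 0; first by rewrite mulr0 size_poly0.
rewrite size_mul // dsz addSn /=.
by apply: leq_trans (leqSpred _) _; rewrite ltnS -size_mul // -EB size_npoly.
Qed.

Lemma monic_split (d : {poly F}) : d \is monic -> (1 < size d)%N ->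
  exists g l, g \is monic /\ d = g * 'X + l%:P.
Proof.
move=> dm sd; exists (d %/ 'X), (d %% 'X)`_0.
have E : d = d %/ 'X * 'X + ((d %% 'X)`_0)%:P.
  rewrite -size1_polyC; first exact: divp_eq.
  by have := ltn_modp d ('X : {poly F}); rewrite monic_neq0 ?monicX // size_polyX ltnS.
split=> //; set g := d %/ 'X in E *; set l := _`_0 in E.
have g0 : g != 0.
  apply: contraTneq sd => g0; rewrite E g0 mul0r add0r -leqNgt.
  exact: size_polyC_leq1.
move: dm; rewrite E monicE lead_coefDl; first by rewrite lead_coefM lead_coefX mulr1 -monicE.
by rewrite size_mulX // (leq_ltn_trans (size_polyC_leq1 _)) // ltnS size_poly_gt0.
Qed.

Lemma size_gcd_mul (g a b : {poly F}) : coprimep a b ->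
  size (gcdp (g * a) (g * b)) = size g.
Proof.
move=> cab; rewrite (eqp_size (gcdp_mul2l _ _ _)).
have [->|g0] := eqVneq g 0; first by rewrite mul0r.
rewrite size_mul ?gcdp_eq0; last 2 first.
- exact: g0.
- by apply: contraTN cab => /andP[/eqP-> /eqP->]; rewrite /coprimep gcdp0 size_poly0.
by move: cab; rewrite /coprimep => /eqP->; rewrite addn1.
Qed.

(** A monic polynomial of positive degree is g X + l for a unique monic g and a unique constant l,
    and the coprime cofactors are kept. Hence [gcd_shift] is injective on F times the old pairs, and
    onto the new ones. *)
Lemma card_gcd_pairs_shift n s :
  #|gcd_pairs n.+1 s.+1| = (q * #|gcd_pairs n s|)%N.
Proof.
have sA0 k (A : {poly F}) : size A == k.+1 -> A != 0 by rewrite -size_poly_eq0 => /eqP->.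
have -> : gcd_pairs n.+1 s.+1 = (@gcd_shift n) @: finset.setX finset.setT (gcd_pairs n s).
  apply/finset.setP => -[A B]; apply/idP/imsetP => [|[[l [A' B']]]]; rewrite ?inE /=.
    move=> /andP[sA sg]; have A0 := sA0 _ _ sA.
    have [u [v [EA EB u0 cuv]]] := monic_gcd_factor B A0.
    have dm := monic_gcd_monic B A0; set d := monic_gcd A B in EA EB dm.
    have sd : (s.+1 < size d)%N by rewrite (eqp_size (monic_gcd_eqp B A0)).
    have [g [l [gm Ed]]] := monic_split dm (leq_ltn_trans (ltn0Sn s) sd).
    have dsz := size_mulXaddC l gm; have gn0 := monic_neq0 gm; have dn0 := monic_neq0 dm.
    have sgu : size (g * u) = n.+1.
      apply: succn_inj; rewrite -(eqP sA) EA !size_mul // Ed dsz addSn /= prednK //.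
      by rewrite addn_gt0 size_poly_gt0 gn0.
    have sgv : (size (g * v)%R <= n)%N.
      have [->|v0] := eqVneq v 0; first by rewrite mulr0 size_poly0.
      have := size_npoly B; rewrite EB size_mul // Ed dsz addSn /= size_mul //.
      by case: (_ + _)%N.
    have EA' : npolyp n.+1 (g * u) = g * u :> {poly F} by rewrite npolypK ?sgu.
    have EB' : npolyp n (g * v) = g * v :> {poly F} by rewrite npolypK.
    exists (l, (npolyp n.+1 (g * u), npolyp n (g * v))).
      rewrite finset.in_setX /= !inE /= EA' EB' sgu eqxx /= size_gcd_mul //.
      by move: sd; rewrite Ed dsz ltnS.
    have [e1 e2] := gcd_shiftE (z := (l, (npolyp n.+1 (g * u), npolyp n (g * v)))) gm u0 cuv sgu EA' EB'.
    rewrite [RHS]surjective_pairing; congr (_, _); apply: val_inj.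
      by rewrite /= -[RHS]/(polyn _) e1 EA Ed.
    by rewrite /= -[RHS]/(polyn _) e2 EB Ed.
  move=> /andP[sA sg] EAB.
  have A0 := sA0 _ _ sA.
  have [u [v [EA EB u0 cuv]]] := monic_gcd_factor B' A0.
  have gm := monic_gcd_monic B' A0; have dsz := size_mulXaddC l gm.
  have sz : size (monic_gcd A' B' * u) = n.+1 by rewrite -EA (eqP sA).
  have [e1 e2] := gcd_shiftE (z := (l, (A', B'))) gm u0 cuv sz EA EB.
  rewrite -EAB /= in e1 e2; rewrite e1 e2 size_gcd_mul // dsz ltnS (eqp_size (monic_gcd_eqp B' A0)) sg andbT.
  have d0 := monic_neq0 (monic_mulXaddC l gm).
  rewrite size_mul // dsz addSn /=; have Es := sz; rewrite size_mul ?(monic_neq0 gm) // in Es.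
  apply/eqP; rewrite -[LHS]prednK ?Es //.
  by rewrite addn_gt0 size_poly_gt0 monic_neq0.
rewrite card_in_imset ?finset.cardsX ?cardsT //.
move=> [l [A B]] [l' [A' B']]; rewrite !finset.in_setX /= !inE /= => /andP[sA sg] /andP[sA' sg'] E.
have A0 := sA0 _ _ sA; have A'0 := sA0 _ _ sA'.
have [u [v [EA EB u0 cuv]]] := monic_gcd_factor B A0.
have [u' [v' [EA' EB' u'0 cuv']]] := monic_gcd_factor B' A'0.
have gm := monic_gcd_monic B A0; have gm' := monic_gcd_monic B' A'0.
have sz : size (monic_gcd A B * u) = n.+1 by rewrite -EA (eqP sA).
have sz' : size (monic_gcd A' B' * u') = n.+1 by rewrite -EA' (eqP sA').
have [e1 e2] := gcd_shiftE (z := (l, (A, B))) gm u0 cuv sz EA EB.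
have [e1' e2'] := gcd_shiftE (z := (l', (A', B'))) gm' u'0 cuv' sz' EA' EB'.
move: e1 e2; rewrite E e1' e2' /= => F1 F2.
have := monic_gcd_mul (monic_mulXaddC l gm) u0 cuv.
rewrite -F1 -F2 monic_gcd_mul ?monic_mulXaddC // => Ed.
have d0 := monic_neq0 (monic_mulXaddC l gm).
rewrite Ed in F1 F2; move: F1 F2 => /(mulfI d0) Fu /(mulfI d0) Fv.
have [Eg El] := mulXaddC_inj Ed.
rewrite El; congr (_, (_, _)); apply: val_inj.
  by rewrite /= EA EA' Eg Fu.
by rewrite /= EB EB' Eg Fv.
Qed.

Lemma size_eq_coef (p : {poly F}) n : (size p <= n.+1)%N ->
  (size p == n.+1) = (p`_n != 0).
Proof.
move=> sp; apply/idP/idP => [/eqP sA|An].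
  have -> : n = (size p).-1 by rewrite sA.
  by rewrite -lead_coefE lead_coef_eq0 -size_poly_eq0 sA.
rewrite eqn_leq sp ltnNge.
by apply: contra An => An; rewrite nth_default.
Qed.

Lemma card_gcd_pairs n s : (s <= n)%N ->
  #|gcd_pairs n s| = (q.-1 * q ^ (2 * n - s))%N.
Proof.
elim: s n => [n _|s IH [//|n]]; last first.
  rewrite ltnS => sn; rewrite card_gcd_pairs_shift IH // mulnCA -expnS; congr (_ * _ ^ _)%N.
  by rewrite mulnS addSn; lia.
have -> : gcd_pairs n 0 = ~: finset.setX [set A : {poly_n.+1 F} | (A : {poly F})`_n == 0] finset.setT.
  apply/finset.setP => -[A B]; rewrite !inE /= andbT.
  have sA : (size (A : {poly F}) == n.+1) = ((A : {poly F})`_n != 0).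
    exact: size_eq_coef (size_npoly A).
  rewrite sA; case: eqP => //= /eqP; rewrite -sA => /eqP sA'.
  by rewrite size_poly_gt0 gcdp_eq0 negb_and -size_poly_eq0 sA'.
have q0 : (0 < q)%N by apply/card_gt0P; exists 0.
rewrite cardsCs finset.setCK finset.cardsX cardsT card_prod !card_npoly.
have -> : #|[set A : {poly_n.+1 F} | (A : {poly F})`_n == 0]| = (q ^ n)%N.
  rewrite -(card_npoly F n) -cardsT.
  have inj : injective (fun y : {poly_n F} => npolyp n.+1 (y : {poly F})).
    move=> y z /(congr1 (fun x : {poly_n.+1 F} => (x : {poly F}))).
    by rewrite !npolypK ?(leq_trans (size_npoly _)) // => /val_inj.
  rewrite -(card_imset _ inj); apply: eq_card => A; rewrite !inE.
  apply/idP/imsetP => [/eqP An|[y _ ->]].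
    have sA : (size (A : {poly F}) <= n)%N.
      apply/leq_sizeP => j; rewrite leq_eqVlt => /orP[/eqP <- //|nj].
      by rewrite nth_default // (leq_trans (size_npoly A)).
    exists (npolyp n (A : {poly F})); rewrite ?inE //; apply: val_inj.
    have E : npolyp n (A : {poly F}) = A :> {poly F} by rewrite npolypK.
    apply/esym/(etrans (npolypK _)); last exact: E.
    exact: leq_trans (size_npoly _) (leqnSn n).
  by rewrite npolypK ?(leq_trans (size_npoly _)) // nth_default // size_npoly.
by rewrite expnS subn0 mul2n -addnn expnD -[in RHS]subn1 !mulnBl mul1n mulnA.
Qed.

(** Subtract the pairs whose gcd has degree at least 1 from all pairs: (q - 1) (q^(2n) -
    q^(2n-1)). *)
Lemma card_coprime_pairs n : (0 < n)%N ->
  #|[set z : {poly_n.+1 F} * {poly_n F} |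
     (size (z.1 : {poly F}) == n.+1) && coprimep (z.1 : {poly F}) (z.2 : {poly F})]|
   = (q.-1 ^ 2 * q ^ (2 * n).-1)%N.
Proof.
move=> n0; set S := [set _ | _].
have q0 : (0 < q)%N by apply/card_gt0P; exists 0.
have -> : S = gcd_pairs n 0 :\: gcd_pairs n 1.
  apply/finset.setP => -[A B]; rewrite !inE /= /coprimep.
  case sA : (_ == n.+1) => //=; have A0 : (A : {poly F}) != 0 by rewrite -size_poly_eq0 (eqP sA).
  have : (0 < size (gcdp A B))%N by rewrite size_poly_gt0 gcdp_eq0 negb_and A0.
  by case: (size _) => [//|[|k]] _.
rewrite cardsD (finset.setIidPr _).
  rewrite !card_gcd_pairs // subn0 subn1.
  have -> : (2 * n = (2 * n).-1.+1)%N by lia.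
  by rewrite expnS /= -!mulnBr -mulnA; congr (_ * _)%N; rewrite -{2}[(q ^ _)%N]mul1n -mulnBl subn1.
apply/fintype.subsetP => -[A B]; rewrite !inE /= => /andP[-> h].
exact: ltnW h.
Qed.
End GcdCount.

(** * Laurent expansion of a quotient of polynomials *)

Section Laurent.
Variable F : finFieldType.
Implicit Types (P Q : {poly F}) (x : laurent F).

(** The remainder of P, multiplied by X, has a constant quotient by Q, so it only affects the
    coefficient of index 0. *)
Lemma coef_divp_shift P Q m :
  (('X * P) %/ Q)`_m.+1 = (P %/ Q)`_m.
Proof.
have [->|Q0] := eqVneq Q 0; first by rewrite !divp0 !coef0.
have E : ('X * P) %/ Q = 'X * (P %/ Q) + ('X * (P %% Q)) %/ Q.
  rewrite {1}(divp_eq P Q) mulrDr divpD mulrA mulpK //.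
rewrite E coefD coefXM /= [X in _ + X]nth_default ?addr0 //.
apply: leq_trans (_ : 1 <= _)%N => //.
rewrite size_divp //; have := ltn_modp P Q; rewrite Q0 => sPQ.
have [->|R0] := eqVneq (P %% Q) 0; first by rewrite mulr0 size_poly0.
by rewrite mulrC size_mulX // leq_subLR addn1 prednK ?sPQ // size_poly_gt0.
Qed.

Lemma coef_divp_shiftn P Q k m :
  (('X^k * P) %/ Q)`_(k + m) = (P %/ Q)`_m.
Proof.
by elim: k => [|k IH]; rewrite ?expr0 ?mul1r // exprS -mulrA addSn coef_divp_shift.
Qed.

(* The Laurent series P / Q: multiplying P by X^k shifts the coefficients, which reduces
   all of them to coefficients of polynomial quotients. *)
Definition quot_series P Q : laurent F := fun j =>
  if 0 <= j then (P %/ Q)`_(`|j|%N) else (('X^(`|j|%N) * P) %/ Q)`_0.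

Lemma quot_seriesE P Q (j : int) (k m : nat) : k%:Z + j = m%:Z ->
  quot_series P Q j = (('X^k * P) %/ Q)`_m.
Proof.
move=> E; rewrite /quot_series; case: ifP => j0.
  have -> : m = (k + `|j|)%N by lia.
  by rewrite coef_divp_shiftn.
have -> : k = (m + `|j|)%N by lia.
by rewrite exprD -mulrA -{2}[m]addn0 coef_divp_shiftn.
Qed.

Lemma quot_series_laurent P Q : is_laurent (quot_series P Q).
Proof.
exists (size P)%:Z => j Pj; rewrite (@quot_seriesE _ _ _ 0 `|j|%N); last by lia.
rewrite expr0 mul1r nth_default //; apply: leq_trans (leq_divp _ _) _.
by case: j Pj => // j; rewrite ltz_nat => /ltnW.
Qed.

Lemma pmul_quot_series P Q : Q != 0 -> pmulLS Q (quot_series P Q) = polyLS P.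
Proof.
move=> Q0; apply/funext => e; rewrite /pmulLS /polyLS.
(* The shift by k makes all the exponents e - i nonnegative and puts e + k beyond the degree of any
   remainder modulo Q. *)
pose k := (`|e| + size Q)%N; pose E := absz (k%:Z + e).
have EE : k%:Z + e = E%:Z by rewrite /E /k; lia.
have sE : (size Q <= E)%N by rewrite /E /k; lia.
transitivity ((Q * (('X^k * P) %/ Q))`_E).
  rewrite coefM (big_ord_widen E.+1 (fun i => Q`_i * quot_series P Q (e - i%:Z))) ?leqW //.
  rewrite [RHS](bigID (fun i : 'I_E.+1 => (i < size Q)%N)) /= [X in _ = _ + X]big1 ?addr0.
    apply: eq_bigr => i iQ; congr (_ * _); apply: quot_seriesE.
    by rewrite addrA EE subzn // -ltnS ltn_ord.
  by move=> i; rewrite -leqNgt => iQ; rewrite nth_default // mul0r.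
have -> : Q * (('X^k * P) %/ Q) = 'X^k * P - ('X^k * P) %% Q.
  by rewrite {2}(divp_eq ('X^k * P) Q) addrK mulrC.
rewrite coefB [X in _ - X]nth_default ?subr0; last first.
  by apply: leq_trans sE; rewrite ltnW // ltn_modp.
rewrite coefXnM; case: ifP => kE; case: ifP => e0 //; try by lia.
by congr (_ `_ _); lia.
Qed.

(** Descending induction on the exponent: both series vanish far enough up, and the coefficient of
    exponent k + deg Q of the product determines [x k] from the higher coefficients, through the
    leading coefficient of Q. *)
Lemma pmulLS_inj Q x x' : Q != 0 -> is_laurent x -> is_laurent x' ->
  pmulLS Q x = pmulLS Q x' -> x = x'.
Proof.
move=> Q0 [N Nx] [N' Nx'] E.
have [n0 [n0N n0N']] : exists n0 : nat, N <= n0%:Z /\ N' <= n0%:Z.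
  by exists (`|N| + `|N'|)%N; split; lia.
have H (t : nat) : forall k : int, n0%:Z - t%:Z < k -> x k = x' k.
  elim: t => [|t IH] k kt; first by rewrite Nx ?Nx' //; lia.
  have [kt'|kt'] := ltP (n0%:Z - t%:Z) k; first exact: IH.
  have sQ : (0 < size Q)%N by rewrite size_poly_gt0.
  have := congr1 (fun f : laurent F => f (k + (size Q).-1%:Z)) E.
  rewrite /pmulLS => /eqP; rewrite -subr_eq0 -sumrB => /eqP.
  have sQ' : ((size Q).-1 < size Q)%N by rewrite prednK.
  rewrite (bigD1 (Ordinal sQ')) //= big1 ?addr0; last first.
    move=> i; rewrite -val_eqE /= => iQ; rewrite !IH ?subrr //.
    by have := ltn_ord i; lia.
  rewrite -mulrBr addrK => /eqP; rewrite mulf_eq0 -lead_coefE lead_coef_eq0 (negPf Q0) /= subr_eq0.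
  by move/eqP.
apply/funext => k; apply: (H (n0 + `|k| + 1)%N); lia.
Qed.

(** [divLS] is obtained by choice; uniqueness of the quotient identifies it with the explicit
    [quot_series P Q]. *)
Lemma zquotE P Q (k : nat) : Q != 0 ->
  fracLS (divLS P Q) k = (('X^(k.+1) * P) %/ Q)`_0.
Proof.
move=> Q0; have -> : divLS P Q = quot_series P Q.
  have [l1 l2] := epsilon_spec (inhabits (fun _ : int => 0 : F))
    (fun x => is_laurent x /\ pmulLS Q x = polyLS P)
    (ex_intro _ (quot_series P Q) (conj (quot_series_laurent P Q) (pmul_quot_series P Q0))).
  apply: (pmulLS_inj Q0) => //; first exact: quot_series_laurent.
  by rewrite l2 pmul_quot_series.
by apply: quot_seriesE; lia.
Qed.
End Laurent.

(** * Digits and box discrepancy *)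

Section Digits.
Variable F : finFieldType.
Implicit Types (A B x y w : {poly F}) (n M : nat).

Definition top_digits n M B : {ffun 'I_M -> F} := [ffun k : 'I_M => B`_(n.-1 - k)].
(* The coefficients of Y^-1, ..., Y^-M in the Laurent series y / A. *)
Definition frac_digits M A y : {ffun 'I_M -> F} :=
  [ffun k : 'I_M => (('X^(k.+1) * y) %/ A)`_0].

Lemma top_digitsP n M x y : (0 < n)%N -> (M <= n)%N -> (size x <= n)%N -> (size y <= n)%N ->
  (top_digits n M x == top_digits n M y) = (size (x - y)%R + M <= n)%N.
Proof.
move=> n0 Mn sx sy.
have sxy : (size (x - y)%R <= n)%N.
  by rewrite (leq_trans (size_polyD _ _)) // size_polyN geq_max sx sy.
rewrite addnC -leq_subRL //.
apply/eqP/idP => [/ffunP E|s].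
  apply/leq_sizeP => j nMj; have [nj|jn] := leqP n j.
    by rewrite nth_default // (leq_trans sxy).
  have kM : (n.-1 - j < M)%N by lia.
  have := E (Ordinal kM); rewrite !ffunE /= coefB.
  by have -> : (n.-1 - (n.-1 - j) = j)%N by [lia]; move=> ->; rewrite subrr.
apply/ffunP => k; rewrite !ffunE; apply/eqP; rewrite -subr_eq0 -coefB nth_default //.
by apply: leq_trans s _; have := ltn_ord k; lia.
Qed.

Lemma frac_digits_eq0 n M A w : size A = n.+1 -> (M <= n)%N -> (size w <= n)%N ->
  (frac_digits M A w == [ffun => 0]) = (size w + M <= n)%N.
Proof.
move=> sA Mn sw.
have A0 : A != 0 by rewrite -size_poly_eq0 sA.
apply/eqP/idP => [/ffunP E|s].
  rewrite leqNgt; apply/negP => nw.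
  have w0 : w != 0 by apply: contraTneq nw => ->; rewrite size_poly0 -leqNgt.
  have sw0 : (0 < size w)%N by rewrite size_poly_gt0.
  (* For w nonzero, w / A starts at the power Y^-(n + 1 - size w), which is the digit of index n -
     size w. *)
  have kM : (n - size w < M)%N by rewrite ltn_subLR.
  have := E (Ordinal kM); rewrite !ffunE /= => /eqP; apply/negP.
  have sq : size (('X^((n - size w).+1) * w) %/ A) = 1.
    rewrite size_divp // mulrC size_mulXn // sA /= addSn subnK // subSn ?subnn //.
  have := size_eq_coef (n := 0) (eq_leq sq); rewrite sq eqxx => /esym.
  by [].
apply/ffunP => k; rewrite !ffunE divp_small ?coef0 // mulrC.
have [->|w0] := eqVneq w 0; first by rewrite mul0r size_poly0 sA.
rewrite size_mulXn // sA ltnS; apply: leq_trans s.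
by rewrite addnC leq_add2l.
Qed.

Lemma frac_digitsB M A x y k : frac_digits M A (x - y) k = frac_digits M A x k - frac_digits M A y k.
Proof. by rewrite !ffunE mulrBr divpD divpN coefB. Qed.

Lemma frac_digitsB_eq0 M A x y :
  (frac_digits M A x == frac_digits M A y) = (frac_digits M A (x - y) == [ffun => 0]).
Proof.
apply/eqP/eqP => /ffunP E; apply/ffunP => k; have := E k; rewrite frac_digitsB !ffunE.
  by move=> ->; rewrite subrr.
by move/eqP; rewrite subr_eq0 => /eqP.
Qed.

Lemma frac_digits_mod M A x y : A != 0 -> A %| x - y ->
  frac_digits M A x = frac_digits M A y.
Proof.
move=> A0 /dvdpP[r E]; apply/eqP; rewrite frac_digitsB_eq0; apply/eqP/ffunP => k.
by rewrite !ffunE E mulrA mulpK // coefXnM.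
Qed.
End Digits.

(** * Inverses modulo a polynomial *)

Section PolyInverse.
Variables (F : finFieldType).
Implicit Types (A B y : {poly F}).

(** The quotient rings need a monic modulus; the ideal generated by A is unchanged. *)
Definition monic_of A := (lead_coef A)^-1 *: A.

Lemma monic_of_monic A : A != 0 -> monic_of A \is monic.
Proof. by move=> A0; rewrite monicE lead_coefZ mulVf // lead_coef_eq0. Qed.

Lemma size_monic_of A : A != 0 -> size (monic_of A) = size A.
Proof. by move=> A0; rewrite size_scale // invr_eq0 lead_coef_eq0. Qed.

Lemma monic_of_eqp A : A != 0 -> monic_of A %= A.
Proof. by move=> A0; rewrite eqp_scale // invr_eq0 lead_coef_eq0. Qed.

(* An inverse of B modulo A, meaningful only when A and B are coprime. *)
Definition pinv A B : {poly F} := (in_qpoly (monic_of A) B)^-1 : {poly %/ monic_of A}.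

Section Fixed.
Variables (A : {poly F}) (n : nat).
Hypotheses (n_gt0 : (0 < n)%N) (sA : size A = n.+1).
Local Notation G := {poly %/ monic_of A}.

Let A0 : A != 0. Proof. by rewrite -size_poly_eq0 sA. Qed.
Let sh : size (monic_of A) = n.+1. Proof. by rewrite size_monic_of. Qed.
Let hm : monic_of A \is monic. Proof. exact: monic_of_monic. Qed.

Lemma coprimep_in_qpoly B : coprimep A B = (in_qpoly (monic_of A) B \is a GRing.unit).
Proof.
rewrite (quot_unit n_gt0 sh hm) (val_in_qpoly n_gt0 sh hm) coprimep_modr.
by apply/esym/eqp_coprimepl/monic_of_eqp.
Qed.

Lemma pinv_dvd B : coprimep A B -> A %| B * pinv A B - 1.
Proof.
rewrite coprimep_in_qpoly => uB.
rewrite -(eqp_dvdl _ (monic_of_eqp A0)) -(in_qpoly_eq0 n_gt0 sh hm).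
have E : in_qpoly (monic_of A) (pinv A B) = (in_qpoly (monic_of A) B)^-1 := in_qpolyK _.
by apply/eqP/(addIr 1); rewrite add0r -{1}(in_qpoly1 (monic_of A)) -in_qpolyD subrK in_qpolyM E mulrV.
Qed.

Lemma pinv_uniq B y : coprimep A B -> A %| B * y - 1 -> A %| y - pinv A B.
Proof.
move=> cB dy; have di := pinv_dvd cB.
rewrite -(Gauss_dvdpr _ cB) mulrBr.
have -> : B * y - B * pinv A B = (B * y - 1) - (B * pinv A B - 1) by ring.
by rewrite dvdp_sub.
Qed.

Lemma sum_quot (T : nmodType) (P : pred {poly F}) (g : {poly F} -> T) :
  \sum_(B : {poly_n F} | P (B : {poly F})) g (B : {poly F}) = \sum_(u : G | P (u : {poly F})) g (u : {poly F}).
Proof.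
rewrite (reindex_onto (fun u : G => npolyp n (u : {poly F})) (fun B : {poly_n F} => in_qpoly (monic_of A) B)) /=.
  apply: eq_big => [u|u _]; last by rewrite npolypK ?(size_quot n_gt0 sh hm).
  rewrite npolypK ?(size_quot n_gt0 sh hm) //.
  by rewrite (in_qpolyK) eqxx andbT.
move=> B _; apply: val_inj.
apply/esym/(etrans _ (esym (npolypK _))).
  by apply/esym/(in_qpoly_id n_gt0 sh hm); exact: size_npoly.
exact: (size_quot n_gt0 sh hm (in_qpoly (monic_of A) B)).
Qed.
End Fixed.
End PolyInverse.

(** * Box discrepancy, averaged over the modulus *)

Section Discrepancy.
Variables (R : realFieldType) (F : finFieldType) (n M : nat).
Hypotheses (n_gt0 : (0 < n)%N) (Mn : (M <= n)%N).
Local Notation q := #|F|.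
Local Notation qr := (q%:R : R).
Local Notation I := {ffun 'I_M -> F}.

Definition top_class (A : {poly F}) (x : {poly %/ monic_of A}) : I := top_digits n M x.
(** The scalar [sg] allows for the sign in w_v = (-y', x'): it will be -1 when z_v is the first
    coordinate and 1 when it is the second. *)
Definition frac_class (sg : F) (A : {poly F}) (x : {poly %/ monic_of A}) : I :=
  frac_digits M A (sg *: (x : {poly F})).

Definition box_discrepancy (sg : F) (A : {poly F}) : R :=
  unit_discrepancy R (top_class (A := A)) (frac_class sg (A := A)).

Definition totient_poly (A : {poly F}) : R := \sum_(B : {poly_n F} | coprimep A B) 1.

Section Fixed.
Variables (sg : F) (A : {poly F}).
Hypotheses (sg0 : sg != 0) (sA : size A = n.+1).
Local Notation G := {poly %/ monic_of A}.

Let A0 : A != 0. Proof. by rewrite -size_poly_eq0 sA. Qed.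
Let sh : size (monic_of A) = n.+1. Proof. by rewrite size_monic_of. Qed.
Let hm : monic_of A \is monic. Proof. exact: monic_of_monic. Qed.
Let qr_gt0 : 0 < qr. Proof. by rewrite ltr0n; apply/card_gt0P; exists 0. Qed.

Lemma top_classP (x y : G) : (top_class x == top_class y) = (x - y \in short_set _ n M).
Proof. by rewrite top_digitsP ?(size_quot n_gt0 sh hm) // inE. Qed.

Lemma frac_classP (x y : G) :
  (frac_class sg x == frac_class sg y) = (x - y \in short_set _ n M).
Proof.
rewrite frac_digitsB_eq0 -scalerBr (frac_digits_eq0 sA) // ?inE ?size_scale //.
exact: (size_quot n_gt0 sh hm (x - y)).
Qed.

Lemma box_discrepancy_bound (s : nat) : (3 * s <= n + 2)%N ->
  box_discrepancy sg A ^+ 5 <=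
  6 * #|[set B : {poly_n F} | (s <= (size (gcdp A B)).-1)%N]|%:R * qr ^+ (5 * M + 4 * n).
Proof.
move=> sn.
have cI : #|I| = (q ^ M)%N by rewrite card_ffun card_ord.
apply: le_trans (quot_discrepancy n_gt0 sh hm R Mn sn cI top_classP frac_classP) _.
apply: ler_of_eq; congr (_ * _ * _).
rewrite -!sum1_card !natr_sum.
under eq_bigl do rewrite inE. under [RHS]eq_bigl do rewrite inE.
rewrite (sum_quot n_gt0 sA (fun B => (s <= (size (gcdp A B)).-1)%N) (fun=> 1%:R)).
apply: eq_bigl => u; congr (_ <= _.-1)%N.
by rewrite (eqp_size (eqp_gcdl _ (monic_of_eqp A0))).
Qed.

(** The discrepancy is the L1 distance between the box counts and their expected values, so it
    controls every bounded function of the two boxes. *)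
Lemma sum_coprime_boxes (X : I -> I -> R) (K : R) : (forall i j, `|X i j| <= K) ->
  `| \sum_(B : {poly_n F} | coprimep A B)
       X (top_digits n M B) (frac_digits M A (sg *: pinv A B))
     - totient_poly A * qr ^- (2 * M) * \sum_i \sum_j X i j | <= K * box_discrepancy sg A.
Proof.
move=> XK.
have E : \sum_(B : {poly_n F} | coprimep A B) X (top_digits n M B) (frac_digits M A (sg *: pinv A B))
  = \sum_i \sum_j unit_count R (top_class (A := A)) (frac_class sg (A := A)) i j * X i j.
  rewrite (sum_quot n_gt0 sA (fun B => coprimep A B) (fun B => X (top_digits n M B) (frac_digits M A (sg *: pinv A B)))).
  rewrite /unit_count; under [RHS]eq_bigr do under eq_bigr do rewrite mulr_suml.
  under [RHS]eq_bigr do rewrite exchange_big /=.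
  rewrite [RHS]exchange_big /=; apply: eq_big => [u|u uU].
    by rewrite inE (coprimep_in_qpoly n_gt0 sA) in_qpolyK.
  rewrite (bigD1 (top_class u)) //= (bigD1 (frac_class sg u^-1)) //= !eqxx mul1r.
  rewrite big1 ?addr0 => [|j jn]; last by rewrite [_ == j]eq_sym (negPf jn) andbF mul0r.
  rewrite big1 ?addr0 => [|i jn]; last first.
    by apply: big1 => j _; rewrite [_ == i]eq_sym (negPf jn) mul0r.
  by rewrite /frac_class /pinv in_qpolyK.
have cI : (#|I|%:R : R) ^- 2 = qr ^- (2 * M).
  by rewrite card_ffun card_ord natrX -exprM mulnC.
have totientE : totient_poly A = #|[pred x : G | x \is a GRing.unit]|%:R.
  rewrite /totient_poly (sum_quot n_gt0 sA (fun B => coprimep A B) (fun=> 1)) -sum1_card natr_sum.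
  by apply: eq_bigl => u; rewrite inE (coprimep_in_qpoly n_gt0 sA) in_qpolyK.
rewrite E mulr_sumr -sumrB /box_discrepancy /unit_discrepancy mulr_sumr.
apply: le_trans (ler_norm_sum _ _ _) _; apply: ler_sum => i _.
rewrite mulr_sumr -sumrB mulr_sumr.
apply: le_trans (ler_norm_sum _ _ _) _; apply: ler_sum => j _.
by rewrite cI totientE [_ * _%:R]mulrC -mulrBl normrM mulrC [X in _ <= X]mulrC ler_wpM2l.
Qed.
End Fixed.

(** A case of Young's inequality; it replaces Hölder's inequality in deducing a bound on a sum from
    one on the sum of the fifth powers. *)
Lemma young5 (a b : R) : 0 <= a -> 0 <= b -> 5 * a * b ^+ 4 <= a ^+ 5 + 4 * b ^+ 5.
Proof.
move=> a0 b0; rewrite -subr_ge0.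
have -> : a ^+ 5 + 4 * b ^+ 5 - 5 * a * b ^+ 4 =
  (a - b) ^+ 2 * (a ^+ 3 + 2 * b * a ^+ 2 + 3 * b ^+ 2 * a + 4 * b ^+ 3) by ring.
by rewrite mulr_ge0 ?sqr_ge0 // !addr_ge0 ?mulr_ge0 ?exprn_ge0.
Qed.

(** The pairs counted are those of [gcd_pairs n s]; on average over A, only q^(n - s) residues have
    a gcd of degree >= s with A. *)
Lemma sum_card_deep (s : nat) : (s <= n)%N ->
  (\sum_(A : {poly_n.+1 F} | size (A : {poly F}) == n.+1)
     #|[set B : {poly_n F} | (s <= (size (gcdp A B)).-1)%N]| = q.-1 * q ^ (2 * n - s))%N.
Proof.
move=> sn; rewrite -card_gcd_pairs // -sum1_card.
rewrite (eq_bigr (fun A : {poly_n.+1 F} =>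
  \sum_(B : {poly_n F} | (s <= (size (gcdp A B)).-1)%N) 1)%N); last first.
  by move=> A _; rewrite -sum1_card; apply: eq_bigl => B; rewrite inE.
rewrite pair_big_dep /=; apply: eq_bigl => -[A B]; rewrite inE /=.
case: eqP => //= sA; have A0 : (A : {poly F}) != 0 by rewrite -size_poly_eq0 sA.
have : (0 < size (gcdp A B))%N by rewrite size_poly_gt0 gcdp_eq0 negb_and A0.
by case: (size _).
Qed.

(** On average the fifth power of the discrepancy is at most about q^(5n + 5M - s). With s the
    largest value allowed by [deep_setP], its fifth root is at most about q^(n + M - n/15), which is
    [lam]; [young5] with b = [lam] then bounds the sum itself. *)
Lemma sum_box_discrepancy (sg : F) : sg != 0 ->
  \sum_(A : {poly_n.+1 F} | size (A : {poly F}) == n.+1) box_discrepancy sg A <=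
  2 * (qr ^+ (n + M) / qr ^+ (n %/ 15)) * qr ^+ n.+1.
Proof.
move=> sg0; set r := (n %/ 15)%N; pose s := ((n + 2) %/ 3)%N.
have q1 : 1 <= qr by rewrite ler1n; apply/card_gt0P; exists 0.
have q0 : 0 < qr by apply: lt_le_trans q1.
have s1 : (3 * s <= n + 2)%N by rewrite /s; lia.
have sn : (s <= n)%N by rewrite /s; lia.
have s5r : (5 * r <= s)%N by rewrite /s /r; lia.
set lam := qr ^+ (n + M) / qr ^+ r.
have lam0 : 0 < lam by rewrite divr_gt0 ?exprn_gt0.
set S := \sum_(A | _) _.
have S5 : \sum_(A : {poly_n.+1 F} | size (A : {poly F}) == n.+1) box_discrepancy sg A ^+ 5 <= 6 * (lam ^+ 5 * qr ^+ n.+1).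
  apply: (@le_trans _ _ (\sum_(A : {poly_n.+1 F} | size (A : {poly F}) == n.+1)
     6 * #|[set B : {poly_n F} | (s <= (size (gcdp A B)).-1)%N]|%:R * qr ^+ (5 * M + 4 * n))).
    by apply: ler_sum => A /eqP sA; apply: box_discrepancy_bound.
  have lam5 : lam ^+ 5 * qr ^+ n.+1 = qr ^+ (5 * (n + M) + n.+1) / qr ^+ (5 * r).
    by rewrite /lam expr_div_n -!exprM mulrAC -exprD ![(_ * 5)%N]mulnC.
  rewrite -mulr_suml -mulr_sumr -natr_sum sum_card_deep // lam5 -(mulrA 6) ler_wpM2l //.
  rewrite natrM natrX -mulrA -exprD.
  apply: (@le_trans _ _ (qr * qr ^+ (2 * n - s + (5 * M + 4 * n)))).
    by rewrite ler_wpM2r ?exprn_ge0 ?(ltW q0) // ler_nat leq_pred.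
  rewrite ler_pdivlMr ?exprn_gt0 // -exprS -!exprD.
  by rewrite ler_weXn2l //; lia.
have l5 : 0 <= 4 * lam ^+ 5 by rewrite mulr_ge0 // exprn_ge0 // ltW.
have cA : \sum_(A : {poly_n.+1 F} | size (A : {poly F}) == n.+1) (4 * lam ^+ 5) <= 4 * (lam ^+ 5 * qr ^+ n.+1).
  rewrite sumr_const -[X in X <= _]mulr_natr mulrA ler_wpM2l //.
  by rewrite -natrX ler_nat -card_npoly max_card.
have H : 5 * S * lam ^+ 4 <= 10 * (lam ^+ 5 * qr ^+ n.+1).
  rewrite -mulrA mulr_suml mulr_sumr.
  apply: (@le_trans _ _ (\sum_(A : {poly_n.+1 F} | size (A : {poly F}) == n.+1) (box_discrepancy sg A ^+ 5 + 4 * lam ^+ 5))).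
    apply: ler_sum => A _; rewrite mulrA young5 ?(ltW lam0) //; exact: unit_discrepancy_ge0.
  rewrite big_split /=; apply: le_trans (lerD S5 cA) _; apply: ler_of_eq; ring.
have l4 : 0 < 5 * lam ^+ 4 by rewrite mulr_gt0 ?exprn_gt0.
rewrite -(ler_pM2l l4); apply: le_trans (_ : 5 * S * lam ^+ 4 <= _).
  by apply: ler_of_eq; ring.
by apply: (le_trans H); apply: ler_of_eq; ring.
Qed.

(** With M = 0 there is a single box, and it contains all the units. *)
Lemma box_discrepancy0 (sg : F) (A : {poly F}) : M = 0%N -> size A = n.+1 ->
  box_discrepancy sg A = 0.
Proof.
move=> M0 sA; have cI : #|I| = 1%N by rewrite card_ffun card_ord M0.
have eqI (i j : I) : i = j.
  by apply: (fintype_le1P _); rewrite cI.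
rewrite /box_discrepancy /unit_discrepancy cI expr1n invr1.
apply: big1 => i _; apply: big1 => j _; rewrite mul1r /unit_count.
rewrite -sum1_card natr_sum -sumrB big1 ?normr0 // => u _.
by rewrite (eqI (top_class u) i) (eqI (frac_class sg _) j) !eqxx subrr.
Qed.
End Discrepancy.

(** * Equidistribution in boxes *)

Section BoxSums.
Variables (F : finFieldType).
Local Notation q := #|F|.

(** If a holds the leading digits of A, of degree n, and i those of u, of degree < n, these are the
    leading digits of l A + u. When a has a nonzero first digit, (l, i) parametrises all digit
    vectors bijectively. *)
Definition affine_digits M (a : {ffun 'I_M.+1 -> F}) (l : F) (i : {ffun 'I_M -> F}) :
    {ffun 'I_M.+1 -> F} :=
  [ffun k => l * a k + (if unlift ord0 k is Some k' then i k' else 0)].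

Lemma top_digits_affine n M (A u : {poly F}) (l : F) : (size u <= n)%N ->
  top_digits n.+1 M.+1 (l *: A + u) = affine_digits (top_digits n.+1 M.+1 A) l (top_digits n M u).
Proof.
move=> su; apply/ffunP => k; rewrite !ffunE /= coefD coefZ; congr (_ + _).
case: unliftP => [k'|] -> /=; rewrite ?ffunE; last by rewrite subn0 nth_default.
by rewrite /bump /= add1n; congr (_`_ _); lia.
Qed.

Lemma sum_affine_digits (T : nmodType) M (a : {ffun 'I_M.+1 -> F}) (g : {ffun 'I_M.+1 -> F} -> T) :
  a ord0 != 0 -> \sum_b g b = \sum_l \sum_i g (affine_digits a l i).
Proof.
move=> a0; rewrite pair_big /=.
rewrite (reindex (fun z : F * {ffun 'I_M -> F} => affine_digits a z.1 z.2)) //.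
exists (fun b : {ffun 'I_M.+1 -> F} =>
  (b ord0 / a ord0, [ffun k => b (lift ord0 k) - b ord0 / a ord0 * a (lift ord0 k)])) => [[l i] _|b _] /=.
  have E0 : affine_digits a l i ord0 / a ord0 = l.
    by rewrite ffunE unlift_none addr0 mulfK.
  rewrite E0; congr (_, _); apply/ffunP => k.
  by rewrite !ffunE liftK addrAC subrr add0r.
apply/ffunP => k; rewrite !ffunE; case: unliftP => [k'|] ->.
  by rewrite ffunE addrC subrK.
by rewrite addr0 divfK.
Qed.

Lemma sum_affine_digits0 (T : nmodType) M (a : {ffun 'I_M.+1 -> F}) (g : {ffun 'I_M.+1 -> F} -> T) :
  \sum_(b : {ffun 'I_M.+1 -> F} | b ord0 == 0) g b = \sum_i g (affine_digits a 0 i).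
Proof.
rewrite (reindex (fun i : {ffun 'I_M -> F} => affine_digits a 0 i)).
  by apply: eq_bigl => i; rewrite ffunE mul0r unlift_none addr0 eqxx.
exists (fun b : {ffun 'I_M.+1 -> F} => [ffun k => b (lift ord0 k)]) => [i _|b].
  by apply/ffunP => k; rewrite !ffunE liftK mul0r add0r.
rewrite inE => /eqP b0; apply/ffunP => k; rewrite !ffunE mul0r add0r.
by case: unliftP => [k'|] ->; rewrite ?ffunE.
Qed.

(** Euclidean division: a polynomial of degree at most n has a constant quotient l by A, so reducing
    it modulo A costs one sum over F. *)
Lemma sum_euclid (T : nmodType) n (A : {poly F}) (P : pred {poly F}) (g : {poly F} -> T) : size A = n.+1 ->
  \sum_(B : {poly_n.+1 F} | P B) g B = \sum_l \sum_(u : {poly_n F} | P (l *: A + (u : {poly F}))) g (l *: A + (u : {poly F})).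
Proof.
move=> sA; have A0 : A != 0 by rewrite -size_poly_eq0 sA.
have lA : A`_n = lead_coef A by rewrite lead_coefE sA.
have sz l (u : {poly_n F}) : (size (l *: A + (u : {poly F}))%R <= n.+1)%N.
  rewrite (leq_trans (size_polyD _ _)) // geq_max (leq_trans (size_scale_leq _ _)) ?sA //=.
  by rewrite leqW // size_npoly.
rewrite pair_big_dep /=.
rewrite (reindex (fun z : F * {poly_n F} => npolyp n.+1 (z.1 *: A + (z.2 : {poly F})))) /=.
  by apply: eq_big => [[l u]|[l u] _] /=; rewrite npolypK ?sz.
exists (fun B : {poly_n.+1 F} => ((B : {poly F})`_n / lead_coef A,
    npolyp n ((B : {poly F}) - (((B : {poly F})`_n / lead_coef A) *: A)))) => [[l u] _|B _] /=.
  rewrite npolypK ?sz //.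
  have E : (l *: A + (u : {poly F}))`_n / lead_coef A = l.
    by rewrite coefD coefZ lA [X in _ + X]nth_default ?size_npoly // addr0 mulfK // lead_coef_eq0.
  rewrite E addrAC subrr add0r; congr (_, _); apply: val_inj.
  by apply: npolypK; exact: size_npoly.
have sB : (size ((B : {poly F}) - ((B : {poly F})`_n / lead_coef A) *: A)%R <= n)%N.
  apply/leq_sizeP => j; rewrite leq_eqVlt => /orP[/eqP <-|nj].
    by rewrite coefB coefZ lA divfK ?subrr // lead_coef_eq0.
  rewrite nth_default // (leq_trans (size_polyD _ _)) // size_polyN geq_max (leq_trans (size_npoly B)) //=.
  by rewrite (leq_trans (size_scale_leq _ _)) ?sA.
apply: val_inj; apply: etrans (npolypK _) _.
  by rewrite npolypK // addrC subrK size_npoly.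
by rewrite npolypK // addrC subrK.
Qed.

Lemma pinv_affine n (A u : {poly F}) (l : F) : (0 < n)%N -> size A = n.+1 ->
  pinv A (l *: A + u) = pinv A u.
Proof.
move=> n0 sA; have A0 : A != 0 by rewrite -size_poly_eq0 sA.
have sh : size (monic_of A) = n.+1 by rewrite size_monic_of.
rewrite /pinv in_qpolyD.
have -> : in_qpoly (monic_of A) (l *: A) = 0.
  apply/eqP; rewrite (in_qpoly_eq0 n0 sh (monic_of_monic A0)).
  by rewrite (eqp_dvdl _ (monic_of_eqp A0)) -mul_polyC dvdp_mull.
by rewrite add0r.
Qed.

Lemma coprimep_affine (A u : {poly F}) (l : F) :
  coprimep A (l *: A + u) = coprimep A u.
Proof. by rewrite coprimep_sym -coprimep_modl modpD modpZl modpp scaler0 add0r coprimep_modl coprimep_sym. Qed.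
End BoxSums.

(** * Coprime pairs in boxes *)

Section BoxEquidistribution.
Variables (R : realFieldType) (F : finFieldType) (n M : nat).
Hypothesis n_gt0 : (0 < n)%N.
Local Notation q := #|F|.
Local Notation qr := (q%:R : R).
Local Notation I := {ffun 'I_M -> F}.
Local Notation J := {ffun 'I_M.+1 -> F}.
Local Notation T p := (top_digits n.+1 M.+1 p).
Local Notation ph A := (totient_poly R n A).
Local Notation full A := (size (A : {poly F}) == n.+1).
Variable Delta : R.
Hypothesis DeltaP : forall sg : F, sg != 0 ->
  \sum_(A : {poly_n.+1 F} | full A) box_discrepancy R n M sg A <= Delta.

Let q_gt1 : (1 < q)%N. Proof. by apply/card_gt1P; exists 0, 1; rewrite eq_sym oner_neq0. Qed.
Let qr_gt1 : 1 < qr. Proof. by rewrite ltr1n. Qed.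
Let qr_gt0 : 0 < qr. Proof. exact: lt_trans qr_gt1. Qed.
Let full_head (A : {poly_n.+1 F}) : full A = ((T A : J) ord0 != 0).
Proof. by rewrite (size_eq_coef (size_npoly A)) ffunE subn0. Qed.
Let Delta0 : 0 <= Delta.
Proof.
apply: le_trans (DeltaP (oner_neq0 F)); apply: sumr_ge0 => A _.
exact: unit_discrepancy_ge0.
Qed.

Lemma sum_boxes_short (sg : F) (X : {poly F} -> I -> I -> R) (K : R) : sg != 0 ->
  0 <= K -> (forall A i j, `|X A i j| <= K) ->
  `|\sum_(A : {poly_n.+1 F} | full A) \sum_(B : {poly_n F} | coprimep A B)
       X A (top_digits n M B) (frac_digits M A (sg *: pinv A B))
    - \sum_(A : {poly_n.+1 F} | full A) ph A * qr ^- (2 * M) * \sum_i \sum_j X A i j|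
  <= K * Delta.
Proof.
move=> sg0 K0 XK; rewrite -sumrB; apply: le_trans (ler_norm_sum _ _ _) _.
apply: le_trans (ler_wpM2l K0 (DeltaP sg0)).
rewrite mulr_sumr; apply: ler_sum => A /eqP sA.
exact: sum_coprime_boxes.
Qed.

(** Write B = l A + u: coprimality and the inverse only depend on u. Summing [Psi] over the q values
    of l gives a test function bounded by q K, to which [sum_boxes_short] applies. *)
Lemma sum_boxes_full (sg : F) (Psi : J -> J -> I -> R) (K : R) : sg != 0 ->
  0 <= K -> (forall a b j, `|Psi a b j| <= K) ->
  `|\sum_(A : {poly_n.+1 F} | full A) \sum_(B : {poly_n.+1 F} | coprimep A B)
       Psi (T A) (T B) (frac_digits M A (sg *: pinv A B))
    - qr ^- (2 * M) * \sum_(A : {poly_n.+1 F} | full A) ph A * \sum_b \sum_j Psi (T A) b j|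
  <= qr * K * Delta.
Proof.
move=> sg0 K0 PK.
pose X (A : {poly F}) (i j : I) := \sum_l Psi (T A) (affine_digits (T A) l i) j.
have XK A i j : `|X A i j| <= qr * K.
  apply: le_trans (ler_norm_sum _ _ _) _; rewrite -sumr_const_card; exact: ler_sum.
have := sum_boxes_short sg0 (mulr_ge0 (ltW qr_gt0) K0) XK.
apply: le_trans; apply: ler_of_eq; congr (`|_ - _|).
  apply: eq_bigr => A /eqP sA; rewrite /X exchange_big /=.
  rewrite (sum_euclid (fun B => coprimep A B) (fun B => Psi (T A) (T B) (frac_digits M A (sg *: pinv A B))) sA).
  apply: eq_bigr => l _; apply: eq_big => u; first by rewrite coprimep_affine.
  by rewrite (pinv_affine _ _ n_gt0 sA) top_digits_affine // size_npoly.
rewrite mulr_sumr; apply: eq_bigr => A; rewrite full_head => A0.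
rewrite mulrA [_ * ph A]mulrC; congr (_ * _).
rewrite (sum_affine_digits _ A0) /X.
under [RHS]eq_bigr do rewrite exchange_big /=.
by rewrite [RHS]exchange_big.
Qed.

Lemma card_full_box : \sum_(b : J | b ord0 != 0) (1 : R) = (qr - 1) * qr ^+ M.
Proof.
have E : \sum_(b : J) (1 : R) = \sum_(b : J | b ord0 == 0) (1 : R) + \sum_(b : J | b ord0 != 0) 1.
  exact: bigID.
apply: (addrI (\sum_(b : J | b ord0 == 0) (1 : R))); rewrite -E (sum_affine_digits0 [ffun=> 0]).
by rewrite !sumr_const_card !card_ffun !card_ord !mulr1 !natrX exprS; ring.
Qed.

(* Coprime pairs (A, B) of polynomials of degree n with A and B in prescribed boxes
   may be counted by fixing A or by fixing B; comparing the two counts shows that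
   the sum of totient_poly over a box hardly depends on the box. *)
Lemma totient_poly_equidistribution (theta : J -> R) (K : R) : 0 <= K ->
  (forall a, `|theta a| <= K) ->
  `|\sum_(A : {poly_n.+1 F} | full A) ph A * theta (T A) -
    (\sum_(A : {poly_n.+1 F} | full A) ph A) / ((qr - 1) * qr ^+ M)
      * \sum_(a : J | a ord0 != 0) theta a| <= 4 * K * Delta.
Proof.
move=> K0 tK; set C := \sum_(A : {poly_n.+1 F} | full A) ph A.
set S := \sum_(A : {poly_n.+1 F} | full A) ph A * theta (T A).
set th := \sum_(a : J | a ord0 != 0) theta a.
pose Y := \sum_(A : {poly_n.+1 F} | full A) \sum_(B : {poly_n.+1 F} | full B && coprimep A B) theta (T A).
have cq : qr ^- (2 * M) * qr ^+ M = qr ^- M.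
  by rewrite mul2n -addnn exprD invfM -mulrA mulVf ?mulr1 // expf_neq0 // gt_eqF.
have b1 (a b : J) (j : I) : `|theta a * (b ord0 != 0)%:R| <= K.
  by rewrite normrM normr_nat; case: (_ != _); rewrite ?mulr1 ?mulr0.
have b2 (a b : J) (j : I) : `|theta b * (b ord0 != 0)%:R| <= K.
  by rewrite normrM normr_nat; case: (_ != _); rewrite ?mulr1 ?mulr0.
have H1 := sum_boxes_full (oner_neq0 F) K0 b1.
have H2 := sum_boxes_full (oner_neq0 F) K0 b2.
have E1 : \sum_(A : {poly_n.+1 F} | full A) \sum_(B : {poly_n.+1 F} | coprimep A B)
    theta (T A) * ((T B : J) ord0 != 0)%:R = Y.
  apply: eq_bigr => A _; rewrite [RHS]big_mkcondl /=; apply: eq_bigr => B _.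
  by rewrite full_head; case: (_ != _); rewrite ?mulr1 ?mulr0.
have E2 : \sum_(A : {poly_n.+1 F} | full A) \sum_(B : {poly_n.+1 F} | coprimep A B)
    theta (T B) * ((T B : J) ord0 != 0)%:R = Y.
  rewrite /Y; transitivity (\sum_(A : {poly_n.+1 F} | full A) \sum_(B : {poly_n.+1 F} | full B && coprimep A B) theta (T B)).
    apply: eq_bigr => A _; rewrite [RHS]big_mkcondl /=; apply: eq_bigr => B _.
    by rewrite full_head; case: (_ != _); rewrite ?mulr1 ?mulr0.
  rewrite (exchange_big_dep (fun B : {poly_n.+1 F} => full B)) /=; last by move=> A B _ /andP[].
  apply: eq_bigr => B fB; apply: eq_bigl => A.
  by rewrite fB coprimep_sym.
rewrite E1 in H1; rewrite E2 in H2.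
have G1 : qr ^- (2 * M) * (\sum_(A : {poly_n.+1 F} | full A) ph A *
    \sum_(b : J) \sum_(j : I) theta (T A) * (b ord0 != 0)%:R) = (qr - 1) * S.
  rewrite (eq_bigr (fun A : {poly_n.+1 F} => (qr ^+ M * ((qr - 1) * qr ^+ M)) * (ph A * theta (T A)))).
    have k1 : qr ^- (2 * M) * (qr ^+ M * ((qr - 1) * qr ^+ M)) = qr - 1.
      by rewrite (mulrA (qr ^- (2 * M))) cq mulrCA mulVf ?mulr1 // expf_neq0 // gt_eqF.
    by rewrite -mulr_sumr -/S (mulrA (qr ^- (2 * M))) k1.
  move=> A _.
  transitivity (ph A * (theta (T A) * qr ^+ M * \sum_(b : J | b ord0 != 0) 1)); last first.
    by rewrite card_full_box; ring.
  congr (_ * _); rewrite mulr_sumr [RHS]big_mkcond /=; apply: eq_bigr => b _.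
  rewrite sumr_const_card card_ffun card_ord natrX.
  by case: (_ != _); rewrite /=; ring.
have G2 : qr ^- (2 * M) * (\sum_(A : {poly_n.+1 F} | full A) ph A *
    \sum_(b : J) \sum_(j : I) theta b * (b ord0 != 0)%:R) = qr ^- M * (C * th).
  have -> : \sum_(b : J) \sum_(j : I) theta b * (b ord0 != 0)%:R = qr ^+ M * th.
    rewrite /th mulr_sumr [RHS]big_mkcond /=; apply: eq_bigr => b _.
    rewrite sumr_const_card card_ffun card_ord natrX.
    by case: (_ != _); rewrite /=; ring.
  by rewrite -mulr_suml -/C -cq; ring.
rewrite G1 in H1; rewrite G2 in H2.
have q2 : 2 <= qr by rewrite ler_nat.
have q10 : 0 < qr - 1 by rewrite subr_gt0.
have qM0 : qr ^+ M != 0 by rewrite expf_neq0 // gt_eqF.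
rewrite -(ler_pM2l q10) -{1}(ger0_norm (ltW q10)) -normrM.
have -> : (qr - 1) * (S - C / ((qr - 1) * qr ^+ M) * th) = (Y - qr ^- M * (C * th)) - (Y - (qr - 1) * S).
  by field; rewrite qM0 gt_eqF.
apply: le_trans (ler_normB _ _) _; apply: le_trans (lerD H2 H1) _.
have KD : 0 <= K * Delta by rewrite mulr_ge0.
have -> : qr * K * Delta + qr * K * Delta = (2 * qr) * (K * Delta) by ring.
have -> : (qr - 1) * (4 * K * Delta) = (4 * (qr - 1)) * (K * Delta) by ring.
(* 2 q <= 4 (q - 1) because q >= 2; this is the origin of the constant 4. *)
by rewrite ler_wpM2r //; lra.
Qed.

Lemma sum_totient_poly : \sum_(A : {poly_n.+1 F} | full A) ph A = (qr - 1) ^+ 2 * qr ^+ (2 * n).-1.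
Proof.
have q0 : (0 < q)%N := ltnW q_gt1.
have -> : qr - 1 = q.-1%:R by rewrite -[X in X%:R - 1]prednK // mulrSr addrK.
rewrite -!natrX -natrM -(card_coprime_pairs F n_gt0) -sum1_card natr_sum.
rewrite /totient_poly pair_big_dep /=; apply: eq_bigl => -[A B].
by rewrite inE.
Qed.

(** The second sum is the part with a vanishing first digit of a: [affine_digits b 0 i] is i
    preceded by 0, the digits of a polynomial of degree < n. *)
Lemma sum_boxes_split (Psi : J -> J -> I -> R) :
  \sum_(a : J | a ord0 != 0) \sum_b \sum_j Psi a b j +
  \sum_(b : J | b ord0 != 0) \sum_i \sum_j Psi (affine_digits b 0 i) b j
  = \sum_(a : J) \sum_(b : J | (a ord0 != 0) || (b ord0 != 0)) \sum_j Psi a b j.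
Proof.
rewrite [RHS](bigID (fun a : J => a ord0 != 0)) /=; congr (_ + _).
  by apply: eq_bigr => a ->.
transitivity (\sum_(a : J | a ord0 == 0) \sum_(b : J | b ord0 != 0) \sum_j Psi a b j).
  rewrite (sum_affine_digits0 [ffun => 0]) [RHS]exchange_big; apply: eq_bigr => b _.
  by apply: eq_bigr => i _; apply: eq_bigr => j _; congr (Psi _ _ _); apply/ffunP => k; rewrite !ffunE !mul0r.
apply: eq_big => a; first by rewrite negbK.
by move=> /eqP ->; rewrite eqxx.
Qed.

(** In each double sum the discrepancy bound replaces the inner sum by [totient_poly] times a
    function [th1] or [th2] of the digits of the outer variable; then
    [totient_poly_equidistribution] replaces the totient by its mean [c] over a box. The two main
    terms are put together by [sum_boxes_split]. *)
Theorem box_equidistribution (sg1 sg2 : F) (Psi : J -> J -> I -> R) (K : R) :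
  sg1 != 0 -> sg2 != 0 -> 0 <= K -> (forall a b j, `|Psi a b j| <= K) ->
  `|\sum_(A : {poly_n.+1 F} | full A) \sum_(B : {poly_n.+1 F} | coprimep A B)
       Psi (T A) (T B) (frac_digits M A (sg1 *: pinv A B))
   + \sum_(B : {poly_n.+1 F} | full B) \sum_(A : {poly_n F} | coprimep B A)
       Psi (T A) (T B) (frac_digits M B (sg2 *: pinv B A))
   - (qr - 1) * qr ^+ (2 * n).-1 * qr ^- (3 * M) *
       \sum_(a : J) \sum_(b : J | (a ord0 != 0) || (b ord0 != 0)) \sum_j Psi a b j|
  <= 10 * qr * K * Delta.
Proof.
move=> s1 s2 K0 PK.
set S1 := \sum_(A : {poly_n.+1 F} | full A) \sum_(B : {poly_n.+1 F} | _) _.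
set S2 := \sum_(B : {poly_n.+1 F} | full B) \sum_(A : {poly_n F} | _) _.
pose C := \sum_(A : {poly_n.+1 F} | full A) ph A.
pose c := C / ((qr - 1) * qr ^+ M).
pose th1 (a : J) := qr ^- (2 * M) * \sum_b \sum_j Psi a b j.
pose th2 (b : J) := qr ^- (2 * M) * \sum_i \sum_j Psi (affine_digits b 0 i) b j.
have qM0 : qr ^+ M != 0 by rewrite expf_neq0 // gt_eqF.
have cIr : (#|I|%:R : R) = qr ^+ M by rewrite card_ffun card_ord natrX.
have cJr : (#|J|%:R : R) = qr * qr ^+ M by rewrite card_ffun card_ord natrX exprS.
have iq0 : 0 <= qr ^- (2 * M) by rewrite invr_ge0 exprn_ge0 // ltW.
have q2M : qr ^- (2 * M) * (qr ^+ M * qr ^+ M) = 1.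
  by rewrite -exprD addnn mul2n mulVf // expf_neq0 // gt_eqF.
have b1 a : `|th1 a| <= qr * K.
  rewrite normrM (ger0_norm iq0).
  have : `|\sum_b \sum_j Psi a b j| <= #|J|%:R * (#|I|%:R * K).
    rewrite -!sumr_const_card; apply: le_trans (ler_norm_sum _ _ _) _; apply: ler_sum => b _.
    by apply: le_trans (ler_norm_sum _ _ _) _; apply: ler_sum => j _.
  move/(ler_wpM2l iq0)/le_trans; apply; rewrite cIr cJr.
  have -> : qr ^- (2 * M) * (qr * qr ^+ M * (qr ^+ M * K)) = (qr ^- (2 * M) * (qr ^+ M * qr ^+ M)) * (qr * K) by ring.
  by rewrite q2M mul1r.
have b2 a : `|th2 a| <= K.
  rewrite normrM (ger0_norm iq0).
  have : `|\sum_i \sum_j Psi (affine_digits a 0 i) a j| <= #|I|%:R * (#|I|%:R * K).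
    rewrite -!sumr_const_card; apply: le_trans (ler_norm_sum _ _ _) _; apply: ler_sum => b _.
    by apply: le_trans (ler_norm_sum _ _ _) _; apply: ler_sum => j _.
  move/(ler_wpM2l iq0)/le_trans; apply; rewrite cIr.
  have -> : qr ^- (2 * M) * (qr ^+ M * (qr ^+ M * K)) = (qr ^- (2 * M) * (qr ^+ M * qr ^+ M)) * K by ring.
  by rewrite q2M mul1r.
have H1 := sum_boxes_full s1 K0 PK.
have H2 := totient_poly_equidistribution (mulr_ge0 (ltW qr_gt0) K0) b1.
have H3 : `|S2 - \sum_(B : {poly_n.+1 F} | full B) ph B * th2 (T B)| <= K * Delta.
  pose X (B : {poly F}) (i j : I) := Psi (affine_digits (T B) 0 i) (T B) j.
  have := sum_boxes_short s2 K0 (fun B i j => PK _ _ _ : `|X B i j| <= K).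
  apply: le_trans; apply: ler_of_eq; congr (`|_ - _|).
    apply: eq_bigr => B _; apply: eq_bigr => A _; rewrite /X -top_digits_affine ?size_npoly //.
    by rewrite scale0r add0r.
  by apply: eq_bigr => B _; rewrite /th2 mulrA.
have H4 := totient_poly_equidistribution K0 b2.
rewrite -/C -/c in H2 H4.
have H1' : `|S1 - \sum_(A : {poly_n.+1 F} | full A) ph A * th1 (T A)| <= qr * K * Delta.
  apply: le_trans H1; apply: ler_of_eq; congr (`|_ - _|); rewrite mulr_sumr.
  by apply: eq_bigr => A _; rewrite mulrCA.
have -> : (qr - 1) * qr ^+ (2 * n).-1 * qr ^- (3 * M) *
       \sum_(a : J) \sum_(b : J | (a ord0 != 0) || (b ord0 != 0)) \sum_j Psi a b j =
   c * \sum_(a : J | a ord0 != 0) th1 a + c * \sum_(a : J | a ord0 != 0) th2 a.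
  rewrite -mulrDr /th1 /th2 -!mulr_sumr -mulrDr sum_boxes_split mulrA; congr (_ * _).
  have e3 : qr ^+ (3 * M) = qr ^+ M * qr ^+ M * qr ^+ M.
    by rewrite mulnC exprM exprSr expr2.
  have e2 : qr ^+ (2 * M) = qr ^+ M * qr ^+ M.
    by rewrite mulnC exprM expr2.
  rewrite /c /C sum_totient_poly e3 e2.
  have q10 : qr - 1 != 0 by rewrite subr_eq0 gt_eqF.
  by field; rewrite q10 qM0.
set a1 := \sum_(a : J | _) th1 a in H2 *; set a2 := \sum_(a : J | _) th2 a in H4 *.
set f1 := \sum_(A : {poly_n.+1 F} | _) ph A * th1 _ in H1' H2.
set f2 := \sum_(A : {poly_n.+1 F} | _) ph A * th2 _ in H3 H4.
have -> : S1 + S2 - (c * a1 + c * a2) = (S1 - f1) + (f1 - c * a1) + ((S2 - f2) + (f2 - c * a2)) by ring.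
apply: le_trans (ler_normD _ _) _; apply: le_trans (lerD (ler_normD _ _) (ler_normD _ _)) _.
apply: le_trans (lerD (lerD H1' H2) (lerD H3 H4)) _.
have KD : 0 <= K * Delta by rewrite mulr_ge0.
have -> : qr * K * Delta + 4 * (qr * K) * Delta + (K * Delta + 4 * K * Delta) = (5 * qr + 5) * (K * Delta) by ring.
by rewrite -(mulrA _ K) ler_wpM2r //; have := qr_gt1; lra.
Qed.
End BoxEquidistribution.

(** * Equidistribution of primitive vectors *)

Section NuSum.
Variables (R : realType) (F : finFieldType).
Local Notation q := (qR R F).

Definition digits m (s : nat -> F) : {ffun 'I_m -> F} := [ffun i : 'I_m => s i].

Lemma ext_ord m (u : {ffun 'I_m -> F}) (i : 'I_m) : ext u i = u i.
Proof. by rewrite /ext valK. Qed.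

Lemma digits_ext m (u : {ffun 'I_m -> F}) : digits m (ext u) = u.
Proof. by apply/ffunP => i; rewrite ffunE ext_ord. Qed.

Lemma coef_polc m (u : {ffun 'I_m -> F}) (i : 'I_m) : (polc u)`_i = u i.
Proof. by rewrite coef_poly ltn_ord ext_ord. Qed.

Lemma sum_polc (T : nmodType) m (P : pred {poly F}) (g : {poly F} -> T) :
  \sum_(u : {ffun 'I_m -> F} | P (polc u)) g (polc u) = \sum_(p : {poly_m F} | P p) g p.
Proof.
rewrite [RHS](reindex (fun u : {ffun 'I_m -> F} => npolyp m (polc u))) /=.
  have E (u : {ffun 'I_m -> F}) : npolyp m (polc u) = polc u :> {poly F}.
    by rewrite npolypK // size_poly.
  by apply: eq_big => [u|u _]; rewrite E.
exists (fun p : {poly_m F} => [ffun i : 'I_m => (p : {poly F})`_i]) => [u _|p _].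
  by apply/ffunP => i; rewrite ffunE npolypK ?size_poly // coef_polc.
apply: val_inj; apply: etrans (npolypK _) _; first exact: size_poly.
apply/polyP => i; rewrite coef_poly.
case: ltnP => im; last by rewrite nth_default // (leq_trans (size_npoly p)).
by rewrite -[i in ext _ i]/(nat_of_ord (Ordinal im)) ext_ord ffunE.
Qed.

Lemma prim_coprimep (A B : {poly F}) : prim (A, B) <-> coprimep A B.
Proof.
split=> [[x [y /= E]]|/Bezout_eq1_coprimepP[[x y] /= E]].
  by apply/Bezout_eq1_coprimepP; exists (x, y); rewrite /= mulrC [y * _]mulrC.
by exists x, y; rewrite /= mulrC [_ * y]mulrC.
Qed.

Variable sol : {poly F} * {poly F} -> {poly F} * {poly F}.
Hypothesis hsol : forall v, prim v -> v.1 * (sol v).1 + v.2 * (sol v).2 = 1.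

Lemma size_add_lt (P Q : {poly F}) : (size Q < size P)%N -> (1 < size P)%N -> P + Q <> 1.
Proof. by move=> QP P1 E; move: P1; rewrite -(size_polyDl QP) E size_poly1. Qed.

(* When n > 0, comparing degrees in A x + B y = 1 decides which coordinate of w_v is
   z_(w_v), for every solution (x, y). *)
Lemma zquot_full n M (A B : {poly F}) : (0 < n)%N -> size A = n.+1 -> (size B <= n.+1)%N ->
  coprimep A B -> digits M (zquot sol (A, B)) = frac_digits M A ((-1) *: pinv A B).
Proof.
move=> n0 sA sB cAB; have A0 : A != 0 by rewrite -size_poly_eq0 sA.
have := hsol (proj2 (prim_coprimep A B) cAB); rewrite /=.
rewrite /zquot /wv; case: (sol (A, B)) => x y /= E.
have zA : zv (A, B) = A by rewrite /zv /= sA sB.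
have zw : zv (- y, x) = - y.
  rewrite /zv /= size_polyN; case: ltnP => // yx; case: (size_add_lt _ _ E).
    have x0 : x != 0 by rewrite -size_poly_gt0 (leq_ltn_trans _ yx).
    rewrite (size_mul A0 x0) sA addSn /=.
    have [->|y0] := eqVneq y 0; first by rewrite mulr0 size_poly0 addn_gt0 n0.
    have [->|B0] := eqVneq B 0; first by rewrite mul0r size_poly0 addn_gt0 n0.
    rewrite size_mul //; apply: (@leq_ltn_trans (n + size y)%N); last by rewrite ltn_add2l.
    by rewrite -ltnS prednK ?addn_gt0 ?size_poly_gt0 ?B0 // -addSn leq_add2r.
  have x0 : x != 0 by rewrite -size_poly_gt0 (leq_ltn_trans _ yx).
  by rewrite (size_mul A0 x0) sA addSn /= -addn1 leq_add // size_poly_gt0.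
rewrite zA zw; transitivity (frac_digits M A (- y)).
  by apply/ffunP => k; rewrite !ffunE zquotE.
apply: frac_digits_mod => //; rewrite scaleN1r -opprB opprK dvdpNr addrC.
apply: (pinv_uniq n0 sA cAB); rewrite (_ : B * y - 1 = - (A * x)) ?dvdpNr ?dvdp_mulr //.
by rewrite -E; ring.
Qed.

(** Here z_(w_v) = x and A x = 1 modulo B, so that the inverse carries no sign. *)
Lemma zquot_short n M (A B : {poly F}) : (0 < n)%N -> size B = n.+1 -> (size A <= n)%N ->
  coprimep B A -> digits M (zquot sol (A, B)) = frac_digits M B (1 *: pinv B A).
Proof.
move=> n0 sB sA cBA; have B0 : B != 0 by rewrite -size_poly_eq0 sB.
have cAB : coprimep A B by rewrite coprimep_sym.
have := hsol (proj2 (prim_coprimep A B) cAB); rewrite /=.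
rewrite /zquot /wv; case: (sol (A, B)) => x y /= E.
have zA : zv (A, B) = B by rewrite /zv /= sB leqNgt ltnS sA.
have zw : zv (- y, x) = x.
  rewrite /zv /= size_polyN; case: leqP => // xy.
  have y0 : y != 0.
    apply: contraTneq xy => y0; rewrite y0 size_poly0 leqn0 size_poly_eq0.
    by apply: contra_eqN E => /eqP ->; rewrite y0 !mulr0 addr0 eq_sym oner_neq0.
  have sBy : size (B * y) = (n + size y)%N by rewrite size_mul // sB addSn.
  rewrite addrC in E; case: (size_add_lt _ _ E); rewrite sBy; last first.
    by rewrite -addn1 leq_add // size_poly_gt0.
  have [->|x0] := eqVneq x 0; first by rewrite mulr0 size_poly0 addn_gt0 n0.
  have [->|A0] := eqVneq A 0; first by rewrite mul0r size_poly0 addn_gt0 n0.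
  rewrite size_mul // prednK ?addn_gt0 ?size_poly_gt0 ?A0 //.
  exact: leq_add.
rewrite zA zw scale1r; transitivity (frac_digits M B x).
  by apply/ffunP => k; rewrite !ffunE zquotE.
apply: frac_digits_mod => //.
apply: (pinv_uniq n0 sB cBA); rewrite (_ : A * x - 1 = - (B * y)) ?dvdpNr ?dvdp_mulr //.
by rewrite -E; ring.
Qed.

Local Notation J M := {ffun 'I_M.+1 -> F}.
Local Notation I M := {ffun 'I_M -> F}.

Lemma digits_dirc n M (p : {poly F}) : (M <= n)%N -> digits M.+1 (dirc p n) = top_digits n.+1 M.+1 p.
Proof.
move=> Mn; apply/ffunP => i; rewrite !ffunE /dirc ifT //.
by have := ltn_ord i; lia.
Qed.

Definition box_fun M (Psi : J M -> J M -> I M -> R) : ser F * ser F -> quot F -> R :=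
  fun x y => Psi (digits M.+1 x.1) (digits M.+1 x.2) (digits M y).

(** The ties |A| = |B| belong to the first sum, as in the convention for z_v. *)
Lemma nu_sum_box n M (Psi : J M -> J M -> I M -> R) : (0 < n)%N -> (M <= n)%N ->
  nu_sum sol n (box_fun Psi) = (q ^+ 2 * (q - 1))^-1 * q ^- (2 * n) *
  (\sum_(A : {poly_n.+1 F} | size (A : {poly F}) == n.+1) \sum_(B : {poly_n.+1 F} | coprimep A B)
       Psi (top_digits n.+1 M.+1 A) (top_digits n.+1 M.+1 B) (frac_digits M A ((-1) *: pinv A B))
   + \sum_(B : {poly_n.+1 F} | size (B : {poly F}) == n.+1) \sum_(A : {poly_n F} | coprimep B A)
       Psi (top_digits n.+1 M.+1 A) (top_digits n.+1 M.+1 B) (frac_digits M B (1 *: pinv B A))).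
Proof.
move=> n0 Mn; rewrite /nu_sum; congr (_ * _).
pose H (A B : {poly F}) := box_fun Psi (dirv n (A, B)) (zquot sol (A, B)).
pose P (A B : {poly F}) := coprimep A B && (maxn (size A) (size B) == n.+1).
have PE (A B : {poly F}) : `[< prim (A, B) /\ maxn (size A) (size B) = n.+1 >] = P A B.
  by apply/asboolP/andP => -[/prim_coprimep ? /eqP ?].
transitivity (\sum_(A : {poly_n.+1 F}) \sum_(B : {poly_n.+1 F} | P A B) H A B).
  rewrite -(@sum_polc _ n.+1 xpredT (fun A => \sum_(B : {poly_n.+1 F} | P A B) H A B)).
  apply: eq_bigr => c _; rewrite -(@sum_polc _ n.+1 (P (polc c)) (H (polc c))).
  by apply: eq_big => d; rewrite ?PE.
rewrite (bigID (fun A : {poly_n.+1 F} => size (A : {poly F}) == n.+1)) /=; congr (_ + _).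
  apply: eq_bigr => A /eqP sA; apply: eq_big => B; rewrite /P sA.
    by rewrite (maxn_idPl (size_npoly B)) eqxx andbT.
  move=> /andP[cAB _]; rewrite /H /box_fun /= !digits_dirc //.
  by rewrite (zquot_full _ n0 sA (size_npoly B) cAB).
rewrite (exchange_big_dep (fun B : {poly_n.+1 F} => size (B : {poly F}) == n.+1)) /=; last first.
  move=> A B sA /andP[_ /eqP mx]; move: sA mx; rewrite /maxn; case: ifP => // _ /eqP.
    by move=> _ ->.
  by move=> nA E; case: nA.
apply: eq_bigr => B /eqP sB.
have szA (A : {poly_n.+1 F}) : (size (A : {poly F}) != n.+1) = (size (A : {poly F}) <= n)%N.
  by rewrite -ltnS ltn_neqAle size_npoly andbT.
rewrite (reindex_onto (fun A : {poly_n F} => npolyp n.+1 (A : {poly F})) (fun A : {poly_n.+1 F} => npolyp n (A : {poly F}))) /=; last first.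
  move=> A /andP[sA _]; apply: val_inj; apply: etrans (npolypK _) _.
    by apply: leq_trans (size_npoly _) _.
  by rewrite npolypK // -szA.
have EA (A : {poly_n F}) : npolyp n.+1 (A : {poly F}) = A :> {poly F}.
  by rewrite npolypK // (leq_trans (size_npoly A)).
apply: eq_big => A; rewrite EA.
  have -> : npolyp n (A : {poly F}) == A.
    by apply/eqP/val_inj; apply: npolypK; exact: size_npoly.
  rewrite andbT /P sB coprimep_sym.
  have sA : (size (A : {poly F}) <= n)%N := size_npoly A.
  by rewrite (maxn_idPr (leqW sA)) eqxx andbT; case: eqP => // E; rewrite E ltnn in sA.
move=> /andP[/andP[_ /andP[cAB _]] _]; rewrite /H /box_fun /= !digits_dirc //.
by rewrite (zquot_short _ n0 sB (size_npoly A)) // coprimep_sym.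
Qed.

(** The integral of a function of digits. Since K^/R has total measure 1/q, its q^M boxes have
    measure q^-(M+1), the same as balls given by M + 1 digits in O. *)
Definition box_int M (Psi : J M -> J M -> I M -> R) : R :=
  q ^- (3 * M.+1) *
    \sum_(a : J M) \sum_(b : J M | (a ord0 != 0) || (b ord0 != 0)) \sum_j Psi a b j.

Lemma q_gt1 : 1 < q.
Proof. by rewrite /qR ltr1n; apply/card_gt1P; exists 0, 1; rewrite eq_sym oner_neq0. Qed.
Let q_gt0 : 0 < q. Proof. exact: lt_trans q_gt1. Qed.
Let qX_gt0 k : 0 < q ^+ k. Proof. exact: exprn_gt0. Qed.

Lemma nu_sum_box_Delta n M (Psi : J M -> J M -> I M -> R) (K Delta : R) :
  (0 < n)%N -> (M <= n)%N -> 0 <= K -> (forall a b j, `|Psi a b j| <= K) ->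
  (forall sg : F, sg != 0 ->
     \sum_(A : {poly_n.+1 F} | size (A : {poly F}) == n.+1) box_discrepancy R n M sg A <= Delta) ->
  `|nu_sum sol n (box_fun Psi) - box_int Psi| <=
    (q ^+ 2 * (q - 1))^-1 * q ^- (2 * n) * (10 * q * K * Delta).
Proof.
move=> n0 Mn K0 PK DP.
have q10 : 0 < q - 1 by rewrite subr_gt0 q_gt1.
have kap0 : 0 <= (q ^+ 2 * (q - 1))^-1 * q ^- (2 * n).
  by rewrite mulr_ge0 ?invr_ge0 ?mulr_ge0 ?ltW.
rewrite nu_sum_box //.
have m10 : (-1 : F) != 0 by rewrite oppr_eq0 oner_neq0.
have := box_equidistribution n0 DP m10 (oner_neq0 F) K0 PK.
rewrite -/(qR R F); set S1 := \sum_(A : {poly_n.+1 F} | _) \sum_(B | _) _.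
set S2 := \sum_(A : {poly_n.+1 F} | _) \sum_(B | _) _; rewrite /box_int.
set Z := \sum_(a : J M) _ => H.
apply: le_trans (ler_wpM2l kap0 H); rewrite -[X in _ <= X * _](ger0_norm kap0) -normrM.
apply: ler_of_eq; congr (`|_|); rewrite [RHS]mulrBr; congr (_ - _); rewrite [RHS]mulrA; congr (_ * _).
(* The normalising factor turns (q - 1) q^(2n - 1 - 3M) into q^-(3M + 3), the measure of a box. *)
have E1 : q ^+ (3 * M.+1) = q ^+ (3 * M) * q ^+ 2 * q by rewrite mulnS addnC exprD -mulrA -exprSr.
have E2 : q ^+ (2 * n) = q ^+ (2 * n).-1 * q by rewrite -exprSr prednK // muln_gt0.
rewrite E1 E2; field.
by rewrite !gt_eqF.
Qed.

Lemma nu_sum_box_error n M (Psi : J M -> J M -> I M -> R) (K : R) :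
  (0 < n)%N -> (M <= n)%N -> 0 <= K -> (forall a b j, `|Psi a b j| <= K) ->
  `|nu_sum sol n (box_fun Psi) - box_int Psi| <= 20 * K * q ^+ M / q ^+ (n %/ 15).
Proof.
move=> n0 Mn K0 PK.
have := nu_sum_box_Delta n0 Mn K0 PK (fun sg => @sum_box_discrepancy R F n M n0 Mn sg).
move/le_trans; apply; rewrite -/(qR R F).
have q10 : 0 < q - 1 by rewrite subr_gt0 q_gt1.
have E2 : q ^+ (2 * n) = q ^+ n * q ^+ n by rewrite mulnC exprM expr2.
rewrite E2 exprD (exprS _ n); set x := q ^+ n; set y := q ^+ M; set z := q ^+ (n %/ 15).
have [x0 y0 z0] : [/\ 0 < x, 0 < y & 0 < z] by split; apply: qX_gt0.
have -> : (q ^+ 2 * (q - 1))^-1 / (x * x) * (10 * q * K * (2 * (x * y / z) * (q * x))) =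
  20 * K * y / z / (q - 1) by field; rewrite !gt_eqF.
rewrite ler_pdivrMr // ler_peMr ?divr_ge0 ?mulr_ge0 ?(ltW y0) ?(ltW z0) //.
by rewrite lerBrDr -[1 + 1]/(2%:R) ler_nat -(ltr1n R); exact: q_gt1.
Qed.

(** For M = 0 the discrepancies vanish, so [nu_sum_box_Delta] applies with [Delta] = 0 and any bound
    K. *)
Lemma nu_sum_box0 n (Psi : J 0 -> J 0 -> I 0 -> R) : (0 < n)%N ->
  nu_sum sol n (box_fun Psi) = box_int Psi.
Proof.
move=> n0; apply/eqP; rewrite -subr_eq0 -normr_le0.
pose K := \sum_a \sum_b \sum_j `|Psi a b j|.
have K0 : 0 <= K by do 3!apply: sumr_ge0 => ? _.
have PK a b j : `|Psi a b j| <= K.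
  rewrite /K (bigD1 a) //= (bigD1 b) //= (bigD1 j) //= -!addrA lerDl.
  by rewrite !addr_ge0 //; do ?[apply: sumr_ge0 => ? _].
apply: le_trans (nu_sum_box_Delta (Delta := 0) n0 (leq0n n) K0 PK _) _; last first.
  by rewrite !mulr0.
by move=> sg _; rewrite big1 // => A /eqP sA; rewrite box_discrepancy0.
Qed.

Lemma box_int_le M (Psi : J M -> J M -> I M -> R) (K : R) : 0 <= K ->
  (forall (a b : J M) j, (a ord0 != 0) || (b ord0 != 0) -> `|Psi a b j| <= K) -> `|box_int Psi| <= K.
Proof.
move=> K0 PK; rewrite /box_int normrM ger0_norm ?invr_ge0 ?(ltW (qX_gt0 _)) //.
rewrite mulrC ler_pdivrMr //.
have H : `|\sum_(a : J M) \sum_(b : J M | (a ord0 != 0) || (b ord0 != 0)) \sum_j Psi a b j|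
   <= #|J M|%:R * (#|J M|%:R * (#|I M|%:R * K)).
  rewrite -!sumr_const_card; apply: le_trans (ler_norm_sum _ _ _) _; apply: ler_sum => a _.
  rewrite [X in `|X|]big_mkcond; apply: le_trans (ler_norm_sum _ _ _) _; apply: ler_sum => b _.
  case: ifP => ab; last by rewrite normr0 sumr_ge0.
  by apply: le_trans (ler_norm_sum _ _ _) _; apply: ler_sum => j _; apply: PK.
apply: (le_trans H); rewrite !card_ffun !card_ord !natrX -/(qR R F).
have -> : q ^+ M.+1 * (q ^+ M.+1 * (q ^+ M * K)) = K * q ^+ (M.+1 + (M.+1 + M)).
  by rewrite !exprD; ring.
by rewrite ler_wpM2l // ler_weXn2l ?(ltW q_gt1) //; lia.
Qed.

(** The total mass is exact by the case M = 0; the bound 1 is enough to transfer uniform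
    approximations in [nu_sum_close]. *)
Lemma nu_sum1_le1 n : (0 < n)%N -> nu_sum sol n (fun _ _ => 1) <= 1 :> R.
Proof.
move=> n0; rewrite -[X in nu_sum _ _ X]/(box_fun (M := 0) (fun _ _ _ => 1)) nu_sum_box0 //.
apply: le_trans (ler_norm _) _; apply: box_int_le => // *.
by rewrite normr1.
Qed.

Lemma inS1_dirv n (v : {poly F} * {poly F}) :
  maxn (size v.1) (size v.2) = n.+1 -> inS1 (dirv n v).
Proof.
move=> mx; rewrite /inS1 /= /dirc /= !subn0.
have [E|E] : size v.1 = n.+1 \/ size v.2 = n.+1.
  by move: mx; rewrite /maxn; case: ifP; [right|left].
- by left; rewrite -(size_eq_coef (eq_leq E)) E.
- by right; rewrite -(size_eq_coef (eq_leq E)) E.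
Qed.

Lemma nu_sum_close n (H H' : ser F * ser F -> quot F -> R) (e : R) : (0 < n)%N ->
  0 <= e -> (forall x y, inS1 x -> `|H x y - H' x y| <= e) ->
  `|nu_sum sol n H - nu_sum sol n H'| <= e.
Proof.
move=> n0 e0 He; rewrite /nu_sum -mulrBr.
have q10 : 0 < q - 1 by rewrite subr_gt0 q_gt1.
set kap := _^-1 * _.
have kap0 : 0 <= kap by rewrite mulr_ge0 ?invr_ge0 ?mulr_ge0 ?ltW.
rewrite normrM (ger0_norm kap0).
apply: le_trans (_ : e * nu_sum sol n (fun _ _ => 1) <= _); last first.
  by rewrite ler_piMr // nu_sum1_le1.
rewrite /nu_sum -/kap mulrCA ler_wpM2l // mulr_sumr -sumrB.
apply: le_trans (ler_norm_sum _ _ _) _; apply: ler_sum => c _.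
rewrite mulr_sumr -sumrB.
apply: le_trans (ler_norm_sum _ _ _) _; apply: ler_sum => d /asboolP[_ mx].
by rewrite mulr1; apply: He; apply: inS1_dirv.
Qed.

Lemma nu_sum_le n (H : ser F * ser F -> quot F -> R) (K : R) : (0 < n)%N ->
  0 <= K -> (forall x y, inS1 x -> `|H x y| <= K) -> `|nu_sum sol n H| <= K.
Proof.
move=> n0 K0 HK.
have := @nu_sum_close n H (fun _ _ => 0) K n0 K0.
have -> : nu_sum sol n (fun _ _ => 0) = 0 :> R.
  by rewrite /nu_sum big1 ?mulr0 // => c _; rewrite big1.
by rewrite subr0; apply => x y xS; rewrite subr0; apply: HK.
Qed.

(** * Riemann sums of functions of finitely many digits *)

Definition cat_digits m d (a : {ffun 'I_m -> F}) (b : {ffun 'I_d -> F}) : {ffun 'I_(m + d) -> F} :=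
  [ffun i => match fintype.split i return F with inl j => a j | inr j => b j end].

Lemma cat_digits_lshift m d (a : {ffun 'I_m -> F}) (b : {ffun 'I_d -> F}) i : cat_digits a b (lshift d i) = a i.
Proof. by rewrite ffunE (unsplitK (inl i)). Qed.

Lemma cat_digits_rshift m d (a : {ffun 'I_m -> F}) (b : {ffun 'I_d -> F}) i : cat_digits a b (rshift m i) = b i.
Proof. by rewrite ffunE (unsplitK (inr i)). Qed.

Lemma sum_digits (T : nmodType) m d (g : {ffun 'I_m -> F} -> T) :
  \sum_(u : {ffun 'I_(m + d) -> F}) g (digits m (ext u)) = (\sum_a g a) *+ (#|F| ^ d).
Proof.
rewrite (reindex (fun z : {ffun 'I_m -> F} * {ffun 'I_d -> F} => cat_digits z.1 z.2)) /=.
  rewrite -(pair_bigA _ (fun (a : {ffun 'I_m -> F}) (b : {ffun 'I_d -> F}) => g (digits m (ext (cat_digits a b))))) /=.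
  rewrite -sumrMnl; apply: eq_bigr => a _.
  rewrite (eq_bigr (fun=> g a)) ?sumr_const ?card_ffun ?card_ord // => b _.
  congr (g _); apply/ffunP => i; rewrite ffunE.
  by have := ext_ord (cat_digits a b) (lshift d i); rewrite cat_digits_lshift.
exists (fun u : {ffun 'I_(m + d) -> F} => ([ffun i => u (lshift d i)], [ffun i => u (rshift m i)])).
  by move=> [a b] _ /=; congr (_, _); apply/ffunP => i; rewrite ffunE ?cat_digits_lshift ?cat_digits_rshift.
move=> u _; apply/ffunP => i; rewrite ffunE /= -[in RHS](fintype.splitK i).
by case: (fintype.split i) => j; rewrite ffunE.
Qed.

Lemma sum_digits_le (m k : nat) (g : {ffun 'I_m -> F} -> R) : (m <= k)%N ->
  \sum_(u : {ffun 'I_k -> F}) g (digits m (ext u)) = q ^+ (k - m) * \sum_a g a.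
Proof.
move=> /subnKC E; move: (k - m)%N E => d E; subst k.
by rewrite sum_digits -[LHS]mulr_natl natrX.
Qed.

Lemma ext_ord0 k (u : {ffun 'I_k.+1 -> F}) M : (digits M.+1 (ext u)) ord0 = u ord0.
Proof. by rewrite ffunE -(ext_ord u ord0). Qed.

Lemma inS1_digits M (x : ser F * ser F) :
  inS1 x <-> ((digits M.+1 x.1) ord0 != 0) || ((digits M.+1 x.2) ord0 != 0).
Proof. by rewrite !ffunE; split=> /orP. Qed.

(** Each block of M + 1 digits has q^(k - M) extensions to k + 1 digits, so the Riemann sums are
    constant from level M on and the limit is reached. *)
Lemma riemann_S1 k M (G : J M -> J M -> R) : (M <= k)%N ->
  q ^- (2 * k.+1) * \sum_(u : {ffun 'I_k.+1 -> F}) \sum_(w : {ffun 'I_k.+1 -> F} |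
     (u ord0 != 0) || (w ord0 != 0)) G (digits M.+1 (ext u)) (digits M.+1 (ext w)) =
  q ^- (2 * M.+1) * \sum_(a : J M) \sum_(b : J M | (a ord0 != 0) || (b ord0 != 0)) G a b.
Proof.
move=> Mk; have Mk1 : (M.+1 <= k.+1)%N by [].
pose g (a b : J M) := if (a ord0 != 0) || (b ord0 != 0) then G a b else 0.
have -> : \sum_(a : J M) \sum_(b : J M | (a ord0 != 0) || (b ord0 != 0)) G a b = \sum_a \sum_b g a b.
  by apply: eq_bigr => a _; rewrite big_mkcond.
transitivity (q ^- (2 * k.+1) * \sum_(u : {ffun 'I_k.+1 -> F}) \sum_(w : {ffun 'I_k.+1 -> F})
   g (digits M.+1 (ext u)) (digits M.+1 (ext w))).
  congr (_ * _); apply: eq_bigr => u _; rewrite big_mkcond; apply: eq_bigr => w _.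
  by rewrite /g !ext_ord0.
under eq_bigr do rewrite (sum_digits_le _ Mk1).
rewrite -mulr_sumr (sum_digits_le (fun a => \sum_b g a b) Mk1) !mulrA; congr (_ * _).
have -> : q ^+ (2 * k.+1) = q ^+ (2 * M.+1) * (q ^+ (k.+1 - M.+1) * q ^+ (k.+1 - M.+1)).
  by rewrite -!exprD; congr (_ ^+ _); lia.
by rewrite invfM -!mulrA mulVf ?mulr1 // mulf_neq0 // gt_eqF.
Qed.

Lemma riemann_Q k M (G : I M -> R) : (M <= k)%N ->
  q ^- k.+1 * \sum_(c : {ffun 'I_k -> F}) G (digits M (ext c)) =
  q ^- M.+1 * \sum_j G j.
Proof.
move=> Mk; rewrite (sum_digits_le _ Mk) mulrA; congr (_ * _).
have -> : q ^+ k.+1 = q ^+ M.+1 * q ^+ (k - M) by rewrite -!exprD; congr (_ ^+ _); lia.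
by rewrite invfM -!mulrA mulVf ?mulr1 // gt_eqF.
Qed.

Definition riemann_SQ (h : (ser F * ser F) * quot F -> R) (k : nat) : R :=
  q ^- (2 * k.+1) * q ^- k.+2 *
    \sum_(u : {ffun 'I_k.+1 -> F}) \sum_(w : {ffun 'I_k.+1 -> F} |
        (u ord0 != 0) || (w ord0 != 0))
      \sum_(c : {ffun 'I_k.+1 -> F}) h ((ext u, ext w), ext c).

Lemma riemann_SQ_box k M (Psi : J M -> J M -> I M -> R) : (M <= k)%N ->
  riemann_SQ (fun z => box_fun Psi z.1 z.2) k = box_int Psi.
Proof.
move=> Mk; rewrite /riemann_SQ /box_fun /=.
pose G (a b : J M) := \sum_j Psi a b j.
have -> : \sum_(u : {ffun 'I_k.+1 -> F}) \sum_(w : {ffun 'I_k.+1 -> F} |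
     (u ord0 != 0) || (w ord0 != 0)) \sum_(c : {ffun 'I_k.+1 -> F})
      Psi (digits M.+1 (ext u)) (digits M.+1 (ext w)) (digits M (ext c)) =
   q ^+ (k.+1 - M) * \sum_(u : {ffun 'I_k.+1 -> F}) \sum_(w : {ffun 'I_k.+1 -> F} |
     (u ord0 != 0) || (w ord0 != 0)) G (digits M.+1 (ext u)) (digits M.+1 (ext w)).
  rewrite mulr_sumr; apply: eq_bigr => u _; rewrite mulr_sumr; apply: eq_bigr => w _.
  by rewrite (sum_digits_le _ (leqW Mk)).
have -> : q ^+ k.+2 = q ^+ M.+1 * q ^+ (k.+1 - M) by rewrite -!exprD; congr (_ ^+ _); lia.
rewrite invfM -!mulrA [q ^- (k.+1 - M) * _]mulrA mulVf ?mul1r ?gt_eqF //.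
rewrite mulrCA (riemann_S1 G Mk) mulrA -invfM -exprD /box_int.
by congr (_^-1 * _); congr (_ ^+ _); lia.
Qed.

Lemma riemann_SQ_close (h h' : (ser F * ser F) * quot F -> R) (e : R) k : 0 <= e ->
  (forall x y, inS1 x -> `|h (x, y) - h' (x, y)| <= e) ->
  `|riemann_SQ h k - riemann_SQ h' k| <= e.
Proof.
move=> e0 He; rewrite /riemann_SQ -mulrBr normrM ger0_norm; last first.
  by rewrite mulr_ge0 // invr_ge0 ltW.
rewrite -sumrB -invfM -exprD mulrC ler_pdivrMr //.
have H : `|\sum_(u : {ffun 'I_k.+1 -> F}) (\sum_(w : {ffun 'I_k.+1 -> F} | (u ord0 != 0) || (w ord0 != 0))
      \sum_(c : {ffun 'I_k.+1 -> F}) h ((ext u, ext w), ext c) -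
    \sum_(w : {ffun 'I_k.+1 -> F} | (u ord0 != 0) || (w ord0 != 0))
      \sum_(c : {ffun 'I_k.+1 -> F}) h' ((ext u, ext w), ext c))|
   <= #|J k|%:R * (#|J k|%:R * (#|J k|%:R * e)).
  rewrite -!sumr_const_card; apply: le_trans (ler_norm_sum _ _ _) _; apply: ler_sum => u _.
  rewrite -sumrB [X in `|X|]big_mkcond; apply: le_trans (ler_norm_sum _ _ _) _; apply: ler_sum => w _.
  case: ifP => uw; last by rewrite normr0 sumr_ge0.
  rewrite -sumrB; apply: le_trans (ler_norm_sum _ _ _) _; apply: ler_sum => c _.
  apply: He; apply/(inS1_digits 0); rewrite /= !ffunE.
  by rewrite -(ext_ord u ord0) -(ext_ord w ord0) in uw.
apply: (le_trans H); rewrite !card_ffun !card_ord !natrX -/(qR R F).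
have -> : q ^+ k.+1 * (q ^+ k.+1 * (q ^+ k.+1 * e)) = e * q ^+ (k.+1 + (k.+1 + k.+1)).
  by rewrite !exprD; ring.
by rewrite ler_wpM2l // ler_weXn2l ?(ltW q_gt1) //; lia.
Qed.

Lemma ext_digits m (s : nat -> F) i : (i < m)%N -> ext (digits m s) i = s i.
Proof. by move=> im; rewrite (ext_ord (digits m s) (Ordinal im)) ffunE. Qed.

Lemma inS1_ext_digits M (x : ser F * ser F) : inS1 x -> inS1 (ext (digits M.+1 x.1), ext (digits M.+1 x.2)).
Proof. by rewrite /inS1 /= !ext_digits. Qed.

Lemma limn_eventually (u : nat -> R) (M : nat) (c : R) :
  (forall k, (M <= k)%N -> u k = c) -> limn u = c.
Proof.
move=> H; apply/cvg_lim => //; apply: cvg_near_cst.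
by exists M => // k /= Mk; apply: H.
Qed.

Lemma exists_precision (eps : R) : 0 < eps -> exists M, q ^- M.+1 <= eps.
Proof.
move=> e0; exists (Num.bound eps^-1).
rewrite -[X in _ <= X](invrK eps) lef_pV2 ?posrE ?invr_gt0 //.
apply: le_trans (ltW (archi_boundP _)) _; first by rewrite invr_ge0 ltW.
have q1 : (1 < #|F|)%N by rewrite -(ltr1n R); exact: q_gt1.
rewrite /qR -natrX ler_nat; apply: ltnW (leq_trans (ltn_expl _ q1) _).
by rewrite leq_pexp2l // ltnW.
Qed.

Lemma precision_lt (eps : R) M i : q ^- M.+1 <= eps -> eps < q ^- i -> (i < M.+1)%N.
Proof.
move=> MP ei; rewrite ltnNge; apply/negP => Mi.
have qMi : q ^- i <= q ^- M.+1 by rewrite lef_pV2 ?posrE // ler_weXn2l // ltW // q_gt1.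
by have := lt_le_trans ei (le_trans qMi MP); rewrite ltxx.
Qed.

(** * Products of locally constant functions *)

Section Product.
Variables (eps : R) (f : ser F * ser F -> R) (g : quot F -> R).
Hypotheses (eps0 : 0 < eps) (fP : loc_constS eps f) (gP : loc_constQ eps g).

Let Sf := sup [set `|f x| | x in [set x | inS1 x]]%classic.
Let Sg := sup [set `|g x| | x in [set: quot F]]%classic.

Lemma le_Sf x : inS1 x -> `|f x| <= Sf.
Proof.
move=> xS; apply: ub_le_sup; last by exists x.
by case: fP => -[B HB] _; exists B => _ [y yS <-]; apply: HB.
Qed.

Lemma le_Sg x : `|g x| <= Sg.
Proof.
apply: ub_le_sup; last by exists x.
by case: gP => -[B HB] _; exists B => _ [y _ <-]; apply: HB.
Qed.

Let Sf0 : 0 <= Sf.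
Proof.
apply: le_trans (normr_ge0 (f (fun=> 1, fun=> 1))) (le_Sf _).
by left => /=; exact: oner_neq0.
Qed.
Let Sg0 : 0 <= Sg. Proof. exact: le_trans (normr_ge0 _) (le_Sg (fun=> 0)). Qed.

Lemma normS_ge0 : 0 <= normS eps f.
Proof. by apply: mulr_ge0 => //; rewrite invr_ge0 ltW. Qed.

Lemma normQ_ge0 : 0 <= normQ eps g.
Proof. by apply: mulr_ge0 => //; rewrite invr_ge0 ltW. Qed.

Variable M : nat.
Hypothesis MP : q ^- M.+1 <= eps.

Lemma loc_constS_digits x : inS1 x -> f x = f (ext (digits M.+1 x.1), ext (digits M.+1 x.2)).
Proof.
move=> xS; case: fP => _; apply => //; first exact: inS1_ext_digits.
by move=> i /(precision_lt MP) iM; rewrite /= !ext_digits.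
Qed.

Lemma loc_constQ_digits y : g y = g (ext (digits M y)).
Proof.
by case: gP => _; apply => i /(precision_lt MP) iM; rewrite ext_digits.
Qed.

(** It is set to 0 off the sphere, where nothing is assumed about f. *)
Let Psi (a b : J M) (j : I M) : R :=
  if (a ord0 != 0) || (b ord0 != 0) then f (ext a, ext b) * g (ext j) else 0.

Lemma Psi_le a b j : `|Psi a b j| <= Sf * Sg.
Proof.
rewrite /Psi; case: ifP => ab; last by rewrite normr0 mulr_ge0.
rewrite normrM ler_pM // ?le_Sg // le_Sf //.
by apply/(inS1_digits M); rewrite /= !digits_ext.
Qed.

Lemma nu_sum_product n : (0 < n)%N -> nu_sum sol n (fun x y => f x * g y) = nu_sum sol n (box_fun Psi).
Proof.
move=> n0; apply/eqP; rewrite -subr_eq0 -normr_le0; apply: nu_sum_close => // x y xS.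
rewrite /box_fun /Psi; have /(inS1_digits M) -> := xS.
by rewrite -loc_constS_digits // -loc_constQ_digits subrr normr0.
Qed.

Lemma int_product : intS1 f * intQ g = box_int Psi.
Proof.
have -> : intS1 f = q ^- (2 * M.+1) * \sum_(a : J M) \sum_(b : J M | (a ord0 != 0) || (b ord0 != 0)) f (ext a, ext b).
  apply: (@limn_eventually _ M) => k Mk.
  rewrite -(riemann_S1 (fun a b => f (ext a, ext b)) Mk); congr (_ * _).
  apply: eq_bigr => u _; apply: eq_bigr => w uw; rewrite loc_constS_digits //.
  by apply/(inS1_digits M); rewrite /= !ext_ord0.
have -> : intQ g = q ^- M.+1 * \sum_(j : I M) g (ext j).
  apply: (@limn_eventually _ M) => k Mk.
  rewrite -(riemann_Q (fun j : I M => g (ext j)) Mk); congr (_ * _).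
  by apply: eq_bigr => c _; rewrite -loc_constQ_digits.
rewrite /box_int mulrACA -invfM -exprD; congr (_^-1 * _); first by congr (_ ^+ _); lia.
rewrite mulr_suml; apply: eq_bigr => a _; rewrite mulr_suml; apply: eq_bigr => b ab.
by rewrite mulr_sumr; apply: eq_bigr => j _; rewrite /Psi ab.
Qed.

Lemma product_error_at n : (0 < n)%N ->
  `|nu_sum sol n (fun x y => f x * g y) - intS1 f * intQ g| <=
    20 * (Sf * Sg) * q ^+ M / q ^+ (n %/ 15).
Proof.
move=> n0; rewrite nu_sum_product // int_product.
have K0 : 0 <= Sf * Sg by rewrite mulr_ge0.
have [Mn|nM] := leqP M n; first exact: nu_sum_box_error Psi_le.
(* When M > n the equidistribution says nothing, but q^M / q^(n/15) >= 1 and the trivial bound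
   suffices. *)
apply: (@le_trans _ _ (2 * (Sf * Sg))).
  rewrite (le_trans (ler_normB _ _)) // mulr_natl mulr2n lerD //.
    by apply: nu_sum_le => // x y _; apply: Psi_le.
  by apply: box_int_le => // a b j _; apply: Psi_le.
have q1 : 1 <= q ^+ M / q ^+ (n %/ 15).
  rewrite ler_pdivlMr // mul1r ler_weXn2l ?(ltW q_gt1) //.
  by rewrite (leq_trans (leq_div _ _)) // ltnW.
rewrite -[X in _ <= X]mulrA -mulrA; apply: le_trans (_ : 20 * (Sf * Sg) * 1 <= _); last first.
  by rewrite -mulrA ler_wpM2l // ler_wpM2l.
by rewrite mulr1 ler_wpM2r // ler_nat.
Qed.

(** The factor q^M is at most 1/eps, and the two norms together supply 1/eps^2, which is at least as
    large since 1/eps >= q^M >= 1. *)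
Lemma product_error_min n : (0 < n)%N -> (0 < M)%N -> eps < q ^- M ->
  `|nu_sum sol n (fun x y => f x * g y) - intS1 f * intQ g| <=
    20 / q ^+ (n %/ 15) * normS eps f * normQ eps g.
Proof.
move=> n0 M0 eM; apply: (le_trans (product_error_at n0)).
rewrite /normS /normQ -/Sf -/Sg.
have eI : q ^+ M <= eps^-1 by rewrite -[q ^+ M]invrK lef_pV2 ?posrE ?invr_gt0 // ltW.
have e1 : 1 <= eps^-1.
  by apply: le_trans eI; rewrite exprn_ege1 // ltW // q_gt1.
have -> : 20 / q ^+ (n %/ 15) * (eps^-1 * Sf) * (eps^-1 * Sg) =
   (20 * (Sf * Sg) / q ^+ (n %/ 15)) * (eps^-1 * eps^-1) by ring.
rewrite mulrAC ler_wpM2l ?divr_ge0 ?mulr_ge0 ?(ltW (qX_gt0 _)) //.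
by apply: (le_trans eI); rewrite ler_peMr // ltW // invr_gt0.
Qed.
End Product.

(* When eps >= 1/q the norms carry no useful power of q (they even tend to 0 as eps
   grows), but then M = 0 and the error vanishes identically. *)
Lemma product_error eps f g n : 0 < eps -> loc_constS eps f -> loc_constQ eps g -> (0 < n)%N ->
  `|nu_sum sol n (fun x y => f x * g y) - intS1 f * intQ g| <=
    20 / q ^+ (n %/ 15) * normS eps f * normQ eps g :> R.
Proof.
move=> e0 fP gP n0.
case: (ex_minnP (exists_precision e0)) => -[|M] MP Mmin; last first.
  apply: (product_error_min e0 fP gP MP n0) => //.
  by rewrite ltNge; apply/negP => /Mmin; rewrite ltnn.
rewrite (nu_sum_product fP gP MP) // (int_product e0 fP gP MP) nu_sum_box0 // subrr normr0.
apply: mulr_ge0 (normQ_ge0 e0 gP); apply: mulr_ge0 (normS_ge0 e0 fP).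
by rewrite divr_ge0 // ltW.
Qed.

(** The exponent n / 15 equals 2n / 30; rounding it down costs at most one factor q, and a positive
    delta only weakens the bound. *)
Lemma inv_pow_div15_le (delta : R) n : 0 < delta ->
  q ^- (n %/ 15) <= q * powR q (2 * n%:R * (delta - 30^-1)).
Proof.
move=> d0; have q1 : 1 <= q by rewrite ltW // q_gt1.
have q0 : 0 <= q by apply: ltW.
rewrite -powR_inv1 ?exprn_ge0 // -powR_mulrn // -powRrM mulrN1.
rewrite -{2}[q]powRr1 // -powRD; last by rewrite (gt_eqF q_gt0) implybT.
apply: ler_powR => //.
have H : (n%:R : R) <= 15 * (n %/ 15)%:R + 15.
  rewrite -natrM -natrD ler_nat; lia.
have dn : 0 <= 2 * n%:R * delta by rewrite !mulr_ge0 ?ler0n // ltW.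
by rewrite mulrBr; lra.
Qed.

(** * Compactness and weak convergence *)

Lemma decay (K e : R) M : 0 <= K -> 0 < e ->
  exists N, forall n, (N <= n)%N -> 20 * K * q ^+ M / q ^+ (n %/ 15) <= e.
Proof.
move=> K0 e0; set c := 20 * K * q ^+ M.
have c0 : 0 <= c by rewrite !mulr_ge0 // ltW.
have c1 : 0 < c + 1 by rewrite ltr_wpDl.
have [N HN] := exists_precision (divr_gt0 e0 c1).
exists (15 * N.+1)%N => n Nn.
have H : q ^- (n %/ 15) <= q ^- N.+1.
  by rewrite lef_pV2 ?posrE // ler_weXn2l ?(ltW q_gt1) //; lia.
apply: le_trans (ler_wpM2l c0 (le_trans H HN)) _.
by rewrite mulrCA ler_piMr ?(ltW e0) // ler_pdivrMr // mul1r lerDl.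
Qed.

(** If the root were bad, repeatedly choosing a bad extension would give a branch all of whose
    prefixes are bad. This stands for the compactness of the product of the sphere and K^/R. *)
Lemma konig (T : finType) (good : seq T -> Prop) :
  (forall p, (forall t, good (rcons p t)) -> good p) ->
  (forall s : nat -> T, exists N, good (mkseq s N)) -> good [::].
Proof.
move=> step branch; apply: contrapT => bad0.
have nxt p : ~ good p -> exists t, ~ good (rcons p t).
  by move=> bp; apply: contrapT => nt; apply: bp; apply: step => t; apply: contrapT => bt; apply: nt; exists t.
have [t0 _] := nxt _ bad0.
have [ch chP] : exists ch : seq T -> T, forall p, ~ good p -> ~ good (rcons p (ch p)).
  have := @choice _ _ (fun p t => ~ good p -> ~ good (rcons p t)).
  apply => p; have [gp|bp] := pselect (good p); first by exists t0.
  by have [t bt] := nxt _ bp; exists t.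
pose fix pre k := if k is k'.+1 then rcons (pre k') (ch (pre k')) else [::].
have badpre k : ~ good (pre k) by elim: k => //= k IH; apply: chP.
have [N] := branch (fun k => ch (pre k)).
suff -> : mkseq (fun k => ch (pre k)) N = pre N by exact: badpre.
by elim: N => //= k IH; rewrite mkseqS IH.
Qed.

Definition agree M (x y : (ser F * ser F) * quot F) : Prop :=
  forall i, (i < M)%N -> [/\ x.1.1 i = y.1.1 i, x.1.2 i = y.1.2 i & x.2 i = y.2 i].

(** A prefix is good when h is uniformly continuous on its cylinder, at scale e. The finitely many
    one-letter extensions are combined by the maximum of their precisions, and continuity at the
    point defined by a branch makes some prefix of it good. *)
Lemma unif_cont (h : (ser F * ser F) * quot F -> R) (e : R) : contSQ h -> 0 < e ->
  exists M, forall x y, inS1 x.1 -> inS1 y.1 -> agree M x y -> `|h y - h x| <= e.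
Proof.
move=> hc e0.
pose T : finType := (F * F * F)%type.
pose cyl (p : seq T) (x : (ser F * ser F) * quot F) :=
  forall i, (i < size p)%N -> nth (0, 0, 0) p i = (x.1.1 i, x.1.2 i, x.2 i).
pose good (p : seq T) := exists M, forall x y, inS1 x.1 -> inS1 y.1 -> cyl p x -> cyl p y ->
  agree M x y -> `|h y - h x| <= e.
suff [M HM] : good [::] by exists M => x y xS yS; apply: HM.
apply: konig => [p Hp|s].
  have /choice[Mt HMt] := Hp.
  (* The second summand forces x and y to have the same letter after p, hence to lie in the cylinder
     of the same extension. *)
  exists (\max_t Mt t + (size p).+1)%N => x y xS yS cx cy axy.
  pose i := size p; pose t : T := (x.1.1 i, x.1.2 i, x.2 i).
  have cext z : cyl p z -> t = (z.1.1 i, z.1.2 i, z.2 i) -> cyl (rcons p t) z.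
    move=> cz tz j; rewrite size_rcons ltnS leq_eqVlt nth_rcons => /orP[/eqP ->|jp].
      by rewrite ltnn eqxx.
    by rewrite jp; apply: cz.
  have ty : t = (y.1.1 i, y.1.2 i, y.2 i).
    have [|e1 e2 e3] := axy i; first by rewrite /i addnS ltnS leq_addl.
    by rewrite /t e1 e2 e3.
  apply: (HMt t) => //; [exact: cext|exact: cext|].
  move=> j jM; apply: axy; apply: leq_trans jM _.
  by apply: leq_trans (leq_bigmax t) (leq_addr _ _).
pose x : (ser F * ser F) * quot F := ((fun i => (s i).1.1, fun i => (s i).1.2), fun i => (s i).2).
have cs N z : cyl (mkseq s N) z -> agree N x z.
  move=> cz i iN; have := cz i; rewrite size_mkseq nth_mkseq // => /(_ iN) E.
  by rewrite /x /= E.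
have [xS|xS] := pselect (inS1 x.1); last first.
  (* The first letter decides membership in the sphere, so this cylinder does not meet it. *)
  exists 1%N, 0%N => z y zS _ /cs cz _; case: xS; move: zS; rewrite /inS1.
  by have [//|-> -> _] := cz 0%N.
have [eta [eta0 Heta]] := hc x xS (e / 2) (divr_gt0 e0 (ltr0Sn _ _)).
have [N HN] := exists_precision eta0.
have near z : inS1 z.1 -> agree N.+1 x z -> `|h z - h x| < e / 2.
  move=> zS az; apply: Heta => // [i|i] /(precision_lt HN) iN.
    by have [//|-> -> _] := az i.
  by have [|_ _ ->] := az i; first exact: ltnW.
exists N.+1, 0%N => z y zS yS /cs cz /cs cy _.
have -> : h y - h z = (h y - h x) - (h z - h x) by ring.
apply: le_trans (ler_normB _ _) _; rewrite [e]splitr.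
by rewrite lerD // ltW // near.
Qed.

(** By uniform continuity, h is within e of a box function over the sphere. The Riemann sums and
    [nu_sum] both have mass at most 1, so both end up close to the same number [box_int Psi]. *)
Lemma weak_convergence (h : (ser F * ser F) * quot F -> R) : contSQ h ->
  ((fun n : nat => nu_sum sol n (fun x y => h (x, y))) @ \oo --> intSQ h)%classic.
Proof.
move=> hc.
have approx (e : R) : 0 < e -> exists b N, forall n, (N <= n)%N ->
    `|riemann_SQ h n - b| <= e /\ `|nu_sum sol n (fun x y => h (x, y)) - b| <= e + e.
  move=> e0; have [M HM] := unif_cont hc e0.
  pose Psi (a b : J M) (j : I M) : R :=
    if (a ord0 != 0) || (b ord0 != 0) then h ((ext a, ext b), ext j) else 0.
  pose K := \sum_a \sum_b \sum_j `|Psi a b j|.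
  have K0 : 0 <= K by do 3!apply: sumr_ge0 => ? _.
  have PK a b j : `|Psi a b j| <= K.
    rewrite /K (bigD1 a) //= (bigD1 b) //= (bigD1 j) //= -!addrA lerDl.
    by rewrite !addr_ge0 //; do ?[apply: sumr_ge0 => ? _].
  have close x y : inS1 x -> `|h (x, y) - box_fun Psi x y| <= e.
    move=> xS; rewrite /box_fun /Psi; have /(inS1_digits M) -> := xS.
    apply: HM => //=; first exact: inS1_ext_digits.
    by move=> i iM /=; rewrite !ext_digits // leqW.
  have [N HN] := decay M K0 e0.
  exists (box_int Psi), (N + M.+1)%N => n Nn.
  have [Nn1 Mn] : (N <= n)%N /\ (M < n)%N by lia.
  split.
    rewrite -(riemann_SQ_box Psi (ltnW Mn)); apply: riemann_SQ_close (ltW e0) _ => x y xS.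
    exact: close.
  have n0 : (0 < n)%N by exact: leq_ltn_trans Mn.
  rewrite -[_ - _](subrKA (nu_sum sol n (box_fun Psi))).
  apply: le_trans (ler_normD _ _) _; apply: lerD.
    exact: nu_sum_close (ltW e0) close.
  by apply: le_trans (nu_sum_box_error n0 (ltnW Mn) K0 PK) (HN _ Nn1).
(* [intSQ] is a [limn], meaningful only once the Riemann sums converge; they are Cauchy by
   [approx]. *)
have rcvg : (riemann_SQ h @ \oo --> intSQ h)%classic.
  apply/cauchy_cvgP/cauchyP => e e0.
  have [b [N HN]] := approx _ (divr_gt0 e0 (ltr0Sn _ 1)).
  exists b; exists N => // n /= Nn; rewrite /ball /= distrC.
  have [Hn _] := HN _ Nn; apply: le_lt_trans Hn _.
  by rewrite ltr_pdivrMr // ltr_pMr // ltr1n.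
apply/cvgrPdist_le => e e0.
have e40 : 0 < e / 4 by rewrite divr_gt0.
have [b [N HN]] := approx _ e40.
have /cvgrPdist_le/(_ _ e40)[N' _ HN'] := rcvg.
exists (N + N')%N => // n /= Nn.
have [Nn1 Nn2] : (N <= n)%N /\ (N' <= n)%N by lia.
have [H1 H2] := HN _ Nn1; have H3 := HN' n Nn2.
set v := nu_sum _ _ _ in H2 *.
have -> : intSQ h - v = (intSQ h - riemann_SQ h n) + (riemann_SQ h n - b) - (v - b) by ring.
apply: le_trans (ler_normB _ _) _; apply: le_trans (lerD (ler_normD _ _) H2) _.
apply: le_trans (lerD (lerD H3 H1) (lexx _)) _.
by apply: ler_of_eq; field.
Qed.
End NuSum.

Local Open Scope classical_set_scope.

Theorem theorem1p1 (R : realType) (F : finFieldType)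
  (sol : {poly F} * {poly F} -> {poly F} * {poly F})
  (hsol : forall v, prim v -> v.1 * (sol v).1 + v.2 * (sol v).2 = 1) :
  (forall h : (ser F * ser F) * quot F -> R, contSQ h ->
     (fun n : nat => nu_sum sol n (fun x y => h (x, y))) @ \oo --> intSQ h) /\
  exists tau : R, 0 < tau <= 8^-1 /\
    forall delta : R, 0 < delta ->
      exists (C : R) (n0 : nat), forall (eps : R) (f : ser F * ser F -> R)
        (g : quot F -> R) (n : nat),
        0 < eps -> loc_constS eps f -> loc_constQ eps g -> (n0 <= n)%N ->
        `| nu_sum sol n (fun x y => f x * g y) - intS1 f * intQ g |
          <= C * powR (qR R F) (2 * n%:R * (delta - tau))
               * normS eps f * normQ eps g.
Proof.
split; first by move=> h; apply: weak_convergence.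
exists 30^-1; split; first by apply/andP; split; lra.
(* The factor 20 comes from [product_error], and q from rounding n / 15 down. *)
move=> delta d0; exists (20 * qR R F), 1%N => eps f g n e0 fP gP n0.
apply: le_trans (product_error hsol e0 fP gP n0) _.
rewrite !ler_wpM2r ?(normS_ge0 e0 fP) ?(normQ_ge0 e0 gP) //.
by rewrite -[X in _ <= X]mulrA ler_wpM2l // inv_pow_div15_le.
Qed.
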